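(* Let $A=\bigoplus_{i\in\mathbb{Z}}A_i$ be a $\mathbb{Z}$-graded integral domain and let $F\in A_\omega\setminus\{0\}$ for some $\omega\in\mathbb{Z}$. Let $A[Z_1,\dots,Z_n]$ be a polynomial ring in $n\ge1$ variables over $A$, and let $e_1,\dots,e_n\ge1$ be integers with $\gcd(e_1,\dots,e_n,\omega)=1$. (a) $(Z_1^{e_1}\cdots Z_n^{e_n}-F)$ is a prime ideal of $A[Z_1,\dots,Z_n]$. (b) Let $B=A[Z_1,\dots,Z_n]/(Z_1^{e_1}\cdots Z_n^{e_n}-F)$. If $A$ is a noetherian UFD and $F$ is prime in $A$, then $B$ is a UFD and $\mathrm{frac}(B)\cong\mathrm{frac}(A)^{(n-1)}$.
   Context: For a field $K$, $K^{(m)}$ denotes the field of rational functions in $m$ variables over $K$. *)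

(* Defs.v *)
From HB Require Import structures.
From mathcomp Require Import all_boot all_order all_algebra.
From mathcomp Require Import fraction.
From mathcomp Require Export mpoly.
Set Implicit Arguments. Unset Strict Implicit. Unset Printing Implicit Defensive.
Import Order.TTheory GRing.Theory Num.Theory.
Local Open Scope ring_scope.

Definition pdvd (R : comNzRingType) (a b : R) : Prop := exists c : R, b = c * a.

Definition is_ideal (R : comNzRingType) (I : R -> Prop) : Prop :=
  [/\ I 0, (forall x y, I x -> I y -> I (x + y)) & (forall r x, I x -> I (r * x))].

Definition noetherian (R : comNzRingType) : Prop :=
  forall I : nat -> R -> Prop,
    (forall k, is_ideal (I k)) ->
    (forall k x, I k x -> I k.+1 x) ->
    exists N : nat, forall m, (N <= m)%N -> forall x, I m x -> I N x.

Definition Zgrading (A : comNzRingType) (G : int -> A -> Prop) : Prop :=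
  [/\ (forall i, G i 0 /\ forall x y, G i x -> G i y -> G i (x - y)),
      (forall i j x y, G i x -> G j y -> G (i + j) (x * y)),
      (forall a : A, exists (s : seq int) (f : int -> A),
          [/\ uniq s, (forall i, G i (f i)) & a = \sum_(i <- s) f i])
    & (forall (s : seq int) (f : int -> A), uniq s -> (forall i, G i (f i)) ->
          \sum_(i <- s) f i = 0 -> forall i, i \in s -> f i = 0)].

Definition prime_principal_ideal (R : comNzRingType) (g : R) : Prop :=
  ~ pdvd g 1 /\ forall a b, pdvd g (a * b) -> pdvd g a \/ pdvd g b.

Definition prime_elt (R : comUnitRingType) (p : R) : Prop :=
  [/\ p != 0, p \isn't a GRing.unit &
      forall a b, pdvd p (a * b) -> pdvd p a \/ pdvd p b].

Definition irreducible_elt (R : idomainType) (x : R) : Prop :=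
  [/\ x != 0, x \isn't a GRing.unit &
      forall a b, x = a * b -> a \is a GRing.unit \/ b \is a GRing.unit].

Definition associated (R : idomainType) (x y : R) : Prop :=
  exists u : R, u \is a GRing.unit /\ x = u * y.

Definition UFD (R : idomainType) : Prop :=
  (forall x : R, x != 0 -> x \isn't a GRing.unit ->
     exists s : seq R, (forall y, y \in s -> irreducible_elt y) /\
                       x = \prod_(y <- s) y) /\
  (forall s t : seq R,
     (forall y, y \in s -> irreducible_elt y) ->
     (forall y, y \in t -> irreducible_elt y) ->
     \prod_(y <- s) y = \prod_(y <- t) y ->
     size s = size t /\
     exists t' : seq R, perm_eq t t' /\
       forall i, (i < size s)%N -> associated (nth 0 s i) (nth 0 t' i)).

(* Main.v *)
Require Import Defs.
From HB Require Import structures.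
From mathcomp Require Import all_boot all_order all_algebra.
From mathcomp Require Import fraction.
From mathcomp Require Import mpoly.
From mathcomp Require Import perm generic_quotient ring zify.
From Stdlib Require Import ClassicalEpsilon.
Import Order.TTheory GRing.Theory Num.Theory.
Local Open Scope ring_scope.

Set Implicit Arguments.
Unset Strict Implicit.
Unset Printing Implicit Defensive.

(** Choose a unimodular integer matrix completing the primitive vector
    (-omega, e_1, ..., e_n).  Its rows give Laurent monomials c, zeta_1, ..., zeta_n
    in F, y_1, ..., y_n with prod zeta_j^{e_j} = F c^omega, so that
    a |-> a c^i (a in A_i), Z_j |-> zeta_j kills Z^e - F.  Monomials not divisible
    by Z^e with homogeneous coefficients have distinct exponents in y, hence the
    kernel of this map to a field is exactly (Z^e - F), which is (a).

    Adjoining s |-> c, the same map identifies B[s] localized at s, z_1, ..., z_n with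
    A[y_1, ..., y_n] localized at F, y_1, ..., y_n.  The latter is factorial by
    Gauss' lemma, and s and the z_j are prime in B[s] since F is prime in A; Nagata's
    criterion makes B[s], hence B, factorial.  The finiteness it
    needs, a bound on the power of z_j dividing a given element, comes from normal forms
    modulo Z^e - F: a multiple of z_j^k has coefficients divisible by high powers of F.

    For the fraction field, let t be a homogeneous fraction whose degree delta
    generates the group of degrees, and use t and u = F t^(-omega/delta) as two of the
    coordinates in place of F and y_1: multiplying A_i by c^(i/delta) moves t, so one
    variable less suffices. *)

(** * Factorization into primes *)

(** The gcd condition enters as primitivity of the relation vector. The completing matrix must be
    invertible over the integers, so that the two families of monomials generate the same
    multiplicative group and can be exchanged without fractional exponents. The variable s balances
    transcendence degrees: over A, the ring B has n - 1 and A[y] has n. Multiplying A_i by c^i gives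
    a ring morphism because degrees add, which is why identities are checked on homogeneous
    elements.

    Injectivity of the map on B[s], and of the one used for the fraction field, is proved with a map
    in the opposite direction. That map cannot be extended to all fractions before it is known to be
    injective, so only its graph on admissible fractions is used.

    When omega = 0 the group of degrees may be 0 and have no positive generator. In that case the
    grading is replaced by the trivial one, and t and c become 1. *)

Section Divisibility.
Variable R : idomainType.
Implicit Types a b c p x y : R.

Lemma pdvd_refl a : pdvd a a.
Proof. by exists 1; rewrite mul1r. Qed.

Lemma pdvd_trans b a c : pdvd a b -> pdvd b c -> pdvd a c.
Proof. by move=> [u ->] [v ->]; exists (v * u); rewrite mulrA. Qed.

Lemma pdvd_mull a b c : pdvd a b -> pdvd a (c * b).
Proof. by move=> [u ->]; exists (c * u); rewrite mulrA. Qed.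

Lemma pdvd_mulr a b c : pdvd a b -> pdvd a (b * c).
Proof. by rewrite mulrC; apply: pdvd_mull. Qed.

Lemma pdvd_unit a b : a \is a GRing.unit -> pdvd a b.
Proof. by move=> ua; exists (b / a); rewrite divrK. Qed.

Lemma pdvd1_unit a : pdvd a 1 <-> a \is a GRing.unit.
Proof.
split=> [[c]|ua]; last exact: pdvd_unit.
by move=> e; apply/unitrP; exists c; rewrite [a * c]mulrC -e.
Qed.

Lemma pdvd_unitl u a b : u \is a GRing.unit -> pdvd (u * a) b <-> pdvd a b.
Proof.
move=> uu; split=> [[c ->]|[c ->]]; first by exists (c * u); rewrite mulrA.
by exists (c / u); rewrite mulrA divrK.
Qed.

Lemma pdvd_antisym a b : a != 0 -> pdvd a b -> pdvd b a ->
  exists2 u, u \is a GRing.unit & b = u * a.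
Proof.
move=> a0 [u eu] [v ev]; exists u => //.
apply/unitrP; exists v; rewrite [u * v]mulrC.
suff: v * u = 1 by [].
by apply: (mulIf a0); rewrite mul1r -mulrA -eu -ev.
Qed.

(* Units are allowed, so that no case distinction is needed in factorizations. *)
Definition wprime p := p != 0 /\ forall a b, pdvd p (a * b) -> pdvd p a \/ pdvd p b.

Definition factorial_ring :=
  forall x, x != 0 -> exists s, (forall y, y \in s -> wprime y) /\ x = \prod_(y <- s) y.

Lemma wprime_unit u : u \is a GRing.unit -> wprime u.
Proof.
move=> uu; split; first by apply: contraTneq uu => ->; rewrite unitr0.
by move=> a b _; left; apply: pdvd_unit.
Qed.

Lemma wprime_unitl u p : u \is a GRing.unit -> wprime p -> wprime (u * p).
Proof.
move=> uu [p0 hp]; split.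
  by rewrite mulf_neq0 //; apply: contraTneq uu => ->; rewrite unitr0.
by move=> a b; rewrite !pdvd_unitl //; apply: hp.
Qed.

Lemma prime_elt_wprime p : prime_elt p -> wprime p.
Proof. by case. Qed.

Lemma wprime_prod p (s : seq R) : wprime p -> ~ pdvd p 1 ->
  pdvd p (\prod_(y <- s) y) -> exists2 y, y \in s & pdvd p y.
Proof.
move=> [p0 hp] p1; elim: s => [|x s IH]; first by rewrite big_nil.
rewrite big_cons => /hp [h|/IH [y ys h]].
  by exists x => //; rewrite inE eqxx.
by exists y => //; rewrite inE ys orbT.
Qed.

Lemma prod_neq0 (s : seq R) : (forall y, y \in s -> y != 0) -> \prod_(y <- s) y != 0.
Proof. by move=> h; rewrite prodf_seq_neq0; apply/allP => y ys; apply: h. Qed.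

Lemma prod_unit (s : seq R) : \prod_(y <- s) y \is a GRing.unit ->
  forall y, y \in s -> y \is a GRing.unit.
Proof.
elim: s => // x s IH; rewrite big_cons unitrM => /andP [ux us] y.
by rewrite inE => /orP [/eqP -> //|]; apply: IH.
Qed.

Lemma wprime_split_units (s : seq R) : (forall y, y \in s -> wprime y) ->
  exists u, exists s', [/\ u \is a GRing.unit,
    forall y, y \in s' -> wprime y /\ y \isn't a GRing.unit &
    \prod_(y <- s) y = u * \prod_(y <- s') y].
Proof.
elim: s => [|x s IH] hs; first by exists 1, [::]; rewrite unitr1 !big_nil mul1r.
have [|u [s' [uu hs' e]]] := IH; first by move=> y ys; apply: hs; rewrite inE ys orbT.
case ux: (x \is a GRing.unit).
  by exists (x * u), s'; rewrite unitrM ux uu big_cons e mulrA.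
exists u, (x :: s'); split=> //; last by rewrite !big_cons e mulrCA.
move=> y; rewrite inE => /orP [/eqP ->|/hs' //].
by rewrite ux; split=> //; apply: hs; rewrite inE eqxx.
Qed.

Lemma factorial_nonunit x : factorial_ring -> x != 0 ->
  exists u, exists s', [/\ u \is a GRing.unit,
    forall y, y \in s' -> wprime y /\ y \isn't a GRing.unit &
    x = u * \prod_(y <- s') y].
Proof. by move=> fR /fR [s [hs ->]]; apply: wprime_split_units. Qed.

Lemma wprime_irreducible p : wprime p -> p \isn't a GRing.unit -> irreducible_elt p.
Proof.
move=> [p0 hp] pu; split=> // a b e.
have /hp : pdvd p (a * b) by rewrite -e; apply: pdvd_refl.
have ab0 : a * b != 0 by rewrite -e.
move: ab0; rewrite mulf_eq0 negb_or => /andP [a0 b0].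
case=> [[c ec]|[c ec]]; [right|left]; apply/pdvd1_unit; exists c.
  by apply: (mulfI a0); rewrite mulr1 {1}ec e; ring.
by apply: (mulfI b0); rewrite mulr1 {1}ec e; ring.
Qed.

(** In [a * b = c * p], uniqueness of factorization matches [p], up to a unit, with an irreducible
    factor of [a] or of [b]. *)
Lemma UFD_irreducible_wprime p : UFD R -> irreducible_elt p -> wprime p.
Proof.
move=> [ex un] [p0 pu pirr]; split=> // a b [c e].
have [->|a0] := eqVneq a 0; first by left; exists 0; rewrite mul0r.
have [->|b0] := eqVneq b 0; first by right; exists 0; rewrite mul0r.
have fac x : x != 0 -> x \is a GRing.unit \/ exists s : seq R,
    (forall y, y \in s -> irreducible_elt y) /\ x = \prod_(y <- s) y.
  by move=> x0; case xu: (x \is a GRing.unit); [left|right; apply: ex; rewrite ?xu].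
case: (fac a a0) => [ua|[sa [hsa ea]]].
  by right; exists (a^-1 * c); rewrite -mulrA -e mulKr.
case: (fac b b0) => [ub|[sb [hsb eb]]].
  by left; exists (b^-1 * c); rewrite -mulrA -e mulrC mulrK.
have c0 : c != 0.
  by apply: contra_neq (mulf_neq0 a0 b0) => c0; rewrite e c0 mul0r.
(* A unit [c] has no factorization into irreducibles and is absorbed into the head [p']; hence only
   [pdvd p p'] is asked. *)
have [p' [t [pp' ht et]]] : exists p', exists t : seq R,
    [/\ pdvd p p', forall y, y \in p' :: t -> irreducible_elt y &
        a * b = \prod_(y <- p' :: t) y].
  case: (fac c c0) => [uc|[sc [hsc ec]]].
    exists (c * p), [::]; split; first exact/pdvd_mull/pdvd_refl.
      move=> y; rewrite inE => /eqP ->; split; first by rewrite mulf_neq0.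
        by rewrite unitrM uc.
      move=> x y' exy; have := pirr (c^-1 * x) y'.
      rewrite -mulrA -exy mulKr // => /(_ erefl) [|]; last by right.
      by rewrite unitrM => /andP [_]; left.
    by rewrite big_seq1.
  exists p, sc; split; first exact: pdvd_refl.
    by move=> y; rewrite inE => /orP [/eqP ->|/hsc].
  by rewrite big_cons -ec e mulrC.
have [||sz [t' [pt' asst']]] := un (p' :: t) (sa ++ sb) ht.
- by move=> y; rewrite mem_cat => /orP [/hsa|/hsb].
- by rewrite -et big_cat /= ea eb.
have [u [uu eu]] := asst' 0 isT; rewrite /= in eu.
have st' : (0 < size t')%N by rewrite -(perm_size pt') -sz.
have : nth 0 t' 0 \in sa ++ sb by rewrite (perm_mem pt') mem_nth.
have dv : pdvd p (nth 0 t' 0).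
  apply: pdvd_trans pp' _; exists u^-1; by rewrite eu mulKr.
have big_dvd (s : seq R) y : y \in s -> pdvd y (\prod_(z <- s) z).
  by move=> ys; rewrite (perm_big _ (perm_to_rem ys)) big_cons /=; apply/pdvd_mulr/pdvd_refl.
rewrite mem_cat => /orP [h|h]; [left; rewrite ea|right; rewrite eb];
  exact: pdvd_trans dv (big_dvd _ _ h).
Qed.

Lemma UFD_factorial : UFD R -> factorial_ring.
Proof.
move=> u x x0; case xu: (x \is a GRing.unit).
  exists [:: x]; rewrite big_seq1; split=> // y; rewrite inE => /eqP ->.
  exact: wprime_unit.
have [s [hs ->]] := u.1 x x0 (negbT xu); exists s; split=> // y /hs.
exact: UFD_irreducible_wprime.
Qed.

Lemma factorial_irreducible_wprime p : factorial_ring -> irreducible_elt p -> wprime p.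
Proof.
move=> fR [p0 pu pirr]; have [u [s [uu hs e]]] := factorial_nonunit fR p0.
case: s => [|y s] in hs e *; first by rewrite e big_nil mulr1 uu in pu.
have [wy yu] : wprime y /\ y \isn't a GRing.unit by apply: hs; rewrite inE eqxx.
have /pirr : p = y * (u * \prod_(z <- s) z) by rewrite e big_cons mulrCA.
case=> [h|h]; first by rewrite h in yu.
rewrite e big_cons mulrCA mulrC; exact: wprime_unitl.
Qed.

(** The unit [u] lets the induction close: cancelling a prime of [s] against its associate in [t]
    leaves a unit behind. *)
Lemma factorization_unique u (s t : seq R) : factorial_ring -> u \is a GRing.unit ->
  (forall y, y \in s -> irreducible_elt y) ->
  (forall y, y \in t -> irreducible_elt y) ->
  \prod_(y <- s) y = u * \prod_(y <- t) y ->
  size s = size t /\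
  exists t' : seq R, perm_eq t t' /\
    forall i, (i < size s)%N -> associated (nth 0 s i) (nth 0 t' i).
Proof.
move=> fR; elim: s u t => [|x s IH] u t uu hs ht.
  rewrite big_nil => e; case: t ht e => [|y t] ht e.
    by split=> //; exists [::].
  have [_ yu _] : irreducible_elt y by apply: ht; rewrite inE eqxx.
  case/negP: yu; apply: (@prod_unit (y :: t)); last by rewrite inE eqxx.
  by apply/unitrP; exists u; rewrite -e mulrC -e.
have ix : irreducible_elt x by apply: hs; rewrite inE eqxx.
have [x0 xu xirr] := ix; have wx := factorial_irreducible_wprime fR ix.
rewrite big_cons => e.
have [||y yt [c ec]] := @wprime_prod x t wx; first by rewrite pdvd1_unit; apply/negP.
  exists (u^-1 * \prod_(j <- s) j); apply: (mulrI uu).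
  by rewrite -e mulrA mulrA divrr // mul1r mulrC.
have iy := ht y yt; have uc : c \is a GRing.unit.
  by have [_ _ /(_ _ _ ec) []] := iy => // h; rewrite h in xu.
have [||||sz [t' [pt' asst']]] := IH (u * c) (rem y t).
- by rewrite unitrM uu.
- by move=> z zs; apply: hs; rewrite inE zs orbT.
- by move=> z /mem_rem; apply: ht.
- apply: (mulfI x0); rewrite e (perm_big _ (perm_to_rem yt)) big_cons /= ec; ring.
have pt : perm_eq t (y :: t').
  by rewrite (permPl (perm_to_rem yt)) perm_cons.
split; first by rewrite /= sz (perm_size (perm_to_rem yt)).
exists (y :: t'); split=> // -[|i] hi /=; last exact: asst'.
by exists c^-1; rewrite unitrV ec mulKr.
Qed.

Lemma factorial_UFD : factorial_ring -> UFD R.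
Proof.
move=> fR; split=> [x x0 xu|s t hs ht e]; last first.
  by apply: (@factorization_unique 1); rewrite ?unitr1 ?mul1r.
have [u [s [uu hs e]]] := factorial_nonunit fR x0.
case: s => [|y s] in hs e *; first by rewrite e big_nil mulr1 uu in xu.
exists (u * y :: s); split; last by rewrite e !big_cons mulrA.
have [wy yu] : wprime y /\ y \isn't a GRing.unit by apply: hs; rewrite inE eqxx.
move=> z; rewrite inE => /orP [/eqP ->|zs].
  by apply: wprime_irreducible; [exact: wprime_unitl|rewrite unitrM uu].
by have [|w zu] := hs z; [rewrite inE zs orbT|apply: wprime_irreducible].
Qed.

End Divisibility.

Lemma wprime_bij (P R : idomainType) (f : {rmorphism P -> R}) (g : {rmorphism R -> P}) y :
  cancel f g -> cancel g f -> wprime y -> wprime (g y).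
Proof.
move=> fK gK [y0 hy]; split; first by apply: contraNneq y0 => h; rewrite -(gK y) h rmorph0.
move=> a b [c ec]; have : pdvd y (f a * f b).
  by exists (f c); rewrite -(gK y) -!rmorphM ec.
case/hy=> -[d ed]; [left|right]; exists (g d); by rewrite -rmorphM -ed fK.
Qed.

Lemma factorial_bij (P R : idomainType) (f : {rmorphism P -> R}) (g : {rmorphism R -> P}) :
  cancel f g -> cancel g f -> factorial_ring R -> factorial_ring P.
Proof.
move=> fK gK fR x x0; have [|s [hs e]] := fR (f x).
  by apply: contraNneq x0 => h; rewrite -(fK x) h rmorph0.
exists (map g s); split; last by rewrite -(fK x) e rmorph_prod big_map.
by move=> _ /mapP [y ys ->]; apply: wprime_bij fK gK (hs y ys).
Qed.

(** * Localization and Nagata's criterion *)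

Definition prods (R : idomainType) (S : R -> Prop) (x : R) :=
  exists s : seq R, (forall y, y \in s -> S y) /\ x = \prod_(y <- s) y.

Lemma prods1 (R : idomainType) (S : R -> Prop) : prods S 1.
Proof. by exists [::]; rewrite big_nil. Qed.

Lemma prodsM (R : idomainType) (S : R -> Prop) x y :
  prods S x -> prods S y -> prods S (x * y).
Proof.
move=> [s [hs ->]] [t [ht ->]]; exists (s ++ t); rewrite big_cat; split=> // z.
by rewrite mem_cat => /orP [/hs|/ht].
Qed.

Lemma prods_mem (R : idomainType) (S : R -> Prop) x : S x -> prods S x.
Proof. by exists [:: x]; rewrite big_seq1; split=> // y; rewrite inE => /eqP ->. Qed.

Lemma prods_neq0 (R : idomainType) (S : R -> Prop) x :
  (forall y, S y -> y != 0) -> prods S x -> x != 0.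
Proof. by move=> h [s [hs ->]]; apply: prod_neq0 => y /hs/h. Qed.

Section Localization.
Variables (R : idomainType) (L : fieldType) (f : {rmorphism R -> L}).
Hypothesis f_inj : injective f.
Variable T : R -> Prop.
Hypothesis T_neq0 : forall t, T t -> t != 0.

(** A localization is a subset of a fixed field, so that localizations of two different rings can be
    compared pointwise, as in [same_loc]. *)
Definition loc (l : L) := exists x s, prods T s /\ l * f s = f x.

Lemma inj_rmorph_eq0 x : (f x == 0) = (x == 0).
Proof. by rewrite -(inj_eq f_inj) rmorph0. Qed.

Lemma prods_img_neq0 s : prods T s -> f s != 0.
Proof. by move=> /(prods_neq0 T_neq0); rewrite inj_rmorph_eq0. Qed.

Lemma loc_img x : loc (f x).
Proof. by exists x, 1; rewrite rmorph1 mulr1; split=> //; apply: prods1. Qed.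

Lemma loc_invimg s : prods T s -> loc (f s)^-1.
Proof. by move=> hs; exists 1, s; rewrite rmorph1 mulVf // prods_img_neq0. Qed.

Lemma locM a b : loc a -> loc b -> loc (a * b).
Proof.
move=> [x [s [hs e]]] [y [t [ht e']]]; exists (x * y), (s * t); split.
  exact: prodsM.
by rewrite !rmorphM -e -e'; ring.
Qed.

Lemma locD a b : loc a -> loc b -> loc (a + b).
Proof.
move=> [x [s [hs e]]] [y [t [ht e']]]; exists (x * t + y * s), (s * t); split.
  exact: prodsM.
by rewrite rmorphD !rmorphM -e -e'; ring.
Qed.

Definition loc_dvd (a b : L) := exists c, loc c /\ b = c * a.

Definition loc_wprime (p : L) := [/\ loc p, p != 0 &
  forall a b, loc a -> loc b -> loc_dvd p (a * b) -> loc_dvd p a \/ loc_dvd p b].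

(** A prime of [R] stays prime in the localization or becomes a unit there, and [loc_wprime] admits
    both; the inverse of the denominator is one more unit factor. *)
Lemma factorial_loc l : factorial_ring R -> loc l -> l != 0 ->
  exists s, (forall y, y \in s -> loc_wprime y) /\ l = \prod_(y <- s) y.
Proof.
move=> fR [x [t [ht e]]] l0; have t0 := prods_img_neq0 ht.
have x0 : x != 0 by rewrite -inj_rmorph_eq0 -e mulf_neq0.
have [s [hs ex]] := fR x x0; exists ((f t)^-1 :: map f s); split; last first.
  by rewrite big_cons big_map -rmorph_prod -ex -e mulrC mulfK.
move=> y; rewrite inE => /orP [/eqP ->|/mapP [p ps ->{y}]].
  split=> [||a b la lb _]; [exact: loc_invimg|by rewrite invr_eq0|left].
  exists (a * f t); rewrite mulfK //; split=> //; exact/locM/loc_img.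
have [p0 hp] := hs p ps; split=> [||a b [u [su [hsu eu]]] [v [sv [hsv ev]]]].
- exact: loc_img.
- by rewrite inj_rmorph_eq0.
move=> [c [[w [sw [hsw ew]]] ec]].
have nu := prods_img_neq0 hsu; have nv := prods_img_neq0 hsv.
have nw := prods_img_neq0 hsw.
have : pdvd p (sw * (u * v)).
  exists (w * (su * sv)); apply: f_inj; rewrite !rmorphM -eu -ev -ew.
  have -> : f sw * (a * f su * (b * f sv)) = f sw * f su * f sv * (a * b) by ring.
  by rewrite ec; ring.
case/hp => [[d ed]|/hp [[d ed]|[d ed]]].
(* Here [p] divides an element that is inverted, so [f p] is a unit of the localization and divides
   everything. *)
- left; exists (a * (f d / f sw)); split.
    by apply: locM; [exists u, su|apply: locM; [exact: loc_img|exact: loc_invimg]].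
  rewrite -mulrA; have -> : f d / f sw * f p = f sw / f sw.
    by rewrite [X in _ = f X / _]ed rmorphM; ring.
  by rewrite divff // mulr1.
- left; exists (f d / f su); split.
    by apply: locM; [exact: loc_img|exact: loc_invimg].
  by apply: (mulIf nu); rewrite eu ed rmorphM mulrAC divfK.
- right; exists (f d / f sv); split.
    by apply: locM; [exact: loc_img|exact: loc_invimg].
  by apply: (mulIf nv); rewrite ev ed rmorphM mulrAC divfK.
Qed.

End Localization.

Section Nagata.
Variables (P R : idomainType) (L : fieldType).
Variables (f : {rmorphism P -> L}) (h : {rmorphism R -> L}).
Hypotheses (f_inj : injective f) (h_inj : injective h).
Variables (S : P -> Prop) (T : R -> Prop).
Hypothesis S_wprime : forall s, S s -> wprime s.
Hypothesis S_nonunit : forall s, S s -> ~ pdvd s 1.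
Hypothesis S_bounded : forall x, x != 0 -> exists N : nat, forall s : seq P,
  (forall y, y \in s -> S y) -> pdvd (\prod_(y <- s) y) x -> (size s <= N)%N.
Hypothesis T_neq0 : forall t, T t -> t != 0.
Hypothesis same_loc : forall l, loc f S l <-> loc h T l.

Let S_neq0 s : S s -> s != 0. Proof. by case/S_wprime. Qed.

Definition coprime_to x := forall s, S s -> ~ pdvd s x.

Lemma coprime_part x : x != 0 ->
  exists s, exists y, [/\ prods S s, y != 0, coprime_to y & x = s * y].
Proof.
move=> x0; have [N hN] := S_bounded x0.
(* Either [k] factors from [S] have been split off, or none divides the rest; [S_bounded] excludes
   the first case for [k = N + 1]. *)
have: forall k, exists s : seq P, exists y, [/\ forall z, z \in s -> S z,
    x = (\prod_(z <- s) z) * y & (k <= size s)%N \/ coprime_to y].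
  elim=> [|k [s [y [hs e hk]]]].
    by exists [::], x; rewrite big_nil mul1r; split=> //; left.
  case: (classic (coprime_to y)) => [cy|ncy].
    by exists s, y; split=> //; right.
  case: hk => // hk; have [z hz] : exists z, S z /\ pdvd z y.
    by apply: NNPP => no; apply: ncy => z Sz zy; apply: no; exists z.
  have [Sz [c ec]] := hz; exists (z :: s), c; split.
  - by move=> w; rewrite inE => /orP [/eqP ->|/hs].
  - by rewrite big_cons e ec; ring.
  - by left.
case/(_ N.+1) => s [y [hs e hk]]; exists (\prod_(z <- s) z), y; split=> //.
- by exists s.
- by apply: contraNneq x0 => y0; rewrite e y0 mulr0.
case: hk => // hk; have := hN s hs; rewrite e => /(_ _) H.
have : (size s <= N)%N by apply: H; exists y; rewrite mulrC.
by rewrite leqNgt hk.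
Qed.

(** A prime of [S] dividing [c * q] does not divide [q], so it divides [c] and can be cancelled. *)
Lemma coprime_cancel q s x : coprime_to q -> prods S s -> pdvd q (s * x) -> pdvd q x.
Proof.
move=> cq [t [ht ->{s}]]; elim: t ht => [|y t IH] ht; first by rewrite big_nil mul1r.
rewrite big_cons => -[c ec]; have Sy : S y by apply: ht; rewrite inE eqxx.
have [y0 hy] := S_wprime Sy.
have /hy [[d ed]|/(cq _ Sy) //] : pdvd y (c * q).
  by rewrite -ec -mulrA mulrC; apply/pdvd_mull/pdvd_refl.
apply: IH; first by move=> z zt; apply: ht; rewrite inE zt orbT.
by exists d; apply: (mulfI y0); rewrite mulrA ec ed; ring.
Qed.

(** Up to units of the localization, [q] is the part [p] of its numerator that is coprime to [S].
    Divisibility by [q] descends to divisibility by [p] because factors from [S] cancel. *)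
Lemma nagata_lift q : loc_wprime f S q -> exists s t p,
  [/\ prods S s, prods S t, coprime_to p, wprime p & q * f s = f t * f p].
Proof.
move=> [[x [s [hs e]]] q0 hq]; have s0 := prods_img_neq0 f_inj S_neq0 hs.
have x0 : x != 0 by rewrite -(inj_rmorph_eq0 f_inj) -e mulf_neq0.
have [t [p [ht p0 cp ex]]] := coprime_part x0.
have t0 := prods_img_neq0 f_inj S_neq0 ht.
exists s, t, p; split=> //; last by rewrite e ex rmorphM.
have eq_p : f p = q * (f s / f t) by rewrite mulrA e ex rmorphM mulrC mulKf.
have key a : loc_dvd f S q (f a) -> pdvd p a.
  move=> [c [[y [r [hr ey]]] ec]].
  apply: (@coprime_cancel p (r * s)) => //; first exact: prodsM.
  exists (y * t); apply: f_inj; rewrite !rmorphM ec eq_p -ey.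
  have -> : c * f r * f t * (q * (f s / f t)) = c * f r * q * f s * (f t / f t) by ring.
  by rewrite divff //; ring.
split=> // a b [c ec].
have : loc_dvd f S q (f a * f b).
  exists (f c * (f s / f t)); split.
    apply: locM; first exact: loc_img.
    by apply: locM; [exact: loc_img|exact: loc_invimg].
  by rewrite -rmorphM ec rmorphM eq_p; ring.
by case/(hq _ _ (loc_img _ _ _) (loc_img _ _ _)) => /key; [left|right].
Qed.

Theorem nagata : factorial_ring R -> factorial_ring P.
Proof.
move=> fR x0 x0n0; have [s [x [hs xn0 cx ->]]] := coprime_part x0n0.
have lx : loc h T (f x) by apply/same_loc/loc_img.
have fx0 : f x != 0 by rewrite inj_rmorph_eq0.
have [l [hl el]] := factorial_loc h_inj T_neq0 fR lx fx0.
have lift : exists a b ps, [/\ prods S a, prods S b,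
    forall p, p \in ps -> coprime_to p /\ wprime p &
    (\prod_(y <- l) y) * f a = f b * f (\prod_(y <- ps) y)].
  have hl' y : y \in l -> loc_wprime f S y.
    move=> /hl [ly y0 hy]; split=> //; first exact/same_loc.
    move=> a b /same_loc la /same_loc lb [c [/same_loc lc e]].
    by case: (hy a b la lb) => [|[d [/same_loc ld ed]]|[d [/same_loc ld ed]]];
      [exists c|left; exists d|right; exists d].
  elim: l {hl el} hl' => [|y l IH] hl.
    exists 1, 1, [::]; rewrite !big_nil !rmorph1; split=> //; exact: prods1.
  have [|a [b [ps [ha hb hps e]]]] := IH; first by move=> z zl; apply: hl; rewrite inE zl orbT.
  have [|c [d [p [hc hd cp wp e']]]] := @nagata_lift y; first by apply: hl; rewrite inE eqxx.
  exists (c * a), (d * b), (p :: ps); split; [exact: prodsM|exact: prodsM| |].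
    by move=> z; rewrite inE => /orP [/eqP ->|/hps].
  rewrite !big_cons !rmorphM.
  have -> : y * \prod_(z <- l) z * (f c * f a) = (y * f c) * (\prod_(z <- l) z * f a) by ring.
  by rewrite e e'; ring.
have [a [b [ps [ha hb hps e]]]] := lift.
have {e} e : a * x = b * \prod_(y <- ps) y.
  by apply: f_inj; rewrite !rmorphM -e -el mulrC.
have cprod : coprime_to (\prod_(y <- ps) y).
  move=> z Sz /(wprime_prod (S_wprime Sz) (S_nonunit Sz)) [p /hps [cp _] zp].
  exact: (cp z Sz).
have p0 : \prod_(y <- ps) y != 0 by apply: prod_neq0 => y /hps [_ []].
(* Both [x] and the product of the lifted primes are coprime to [S]; cancelling [a] and [b] makes
   them divide each other. *)
have [||u uu ->] := @pdvd_antisym P (\prod_(y <- ps) y) x p0.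
- by apply: (coprime_cancel cprod ha); rewrite e; apply/pdvd_mull/pdvd_refl.
- by apply: (coprime_cancel cx hb); rewrite -e; apply/pdvd_mull/pdvd_refl.
have [t [ht ->]] := hs; exists (t ++ u :: ps); split.
  move=> y; rewrite mem_cat inE => /or3P [/ht/S_wprime //|/eqP ->|/hps [] //].
  exact: wprime_unit.
by rewrite big_cat big_cons.
Qed.

End Nagata.

(** * Gauss' lemma *)

Local Notation tofrac := (@FracField.tofrac _).

Lemma tofrac_inj (R : idomainType) : injective (@FracField.tofrac R).
Proof. by move=> x y /eqP; rewrite tofrac_eq => /eqP. Qed.

Lemma fraction_rep (R : idomainType) (k : {fraction R}) :
  exists a b : R, b != 0 /\ k = tofrac a / tofrac b.
Proof.
elim/quotW: k => x; exists x.1, x.2; have d0 := denom_ratioP x; split=> //.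
have d0' : tofrac x.2 != 0 by rewrite tofrac_eq0.
apply: (mulIf d0'); rewrite divfK //.
unlock FracField.tofrac; rewrite -[LHS]FracField.pi_mul /FracField.mulf /=.
apply/eqmodP; rewrite /= FracField.equivfE !numden_Ratio ?mulr1 ?oner_neq0 //.
by rewrite mulrC.
Qed.

Lemma poly_field_factorial (K : fieldType) : factorial_ring {poly K}.
Proof.
move=> p; have [n] := ubnP (size p); elim: n p => // n IH p hn p0.
have [sz|sz] := leqP (size p) 1.
  exists [:: p]; rewrite big_seq1; split=> // y; rewrite inE => /eqP ->.
  apply: wprime_unit; rewrite poly_unitE; move: sz; rewrite leq_eqVlt ltnS leqn0 size_poly_eq0.
  by rewrite (negbTE p0) orbF => /[dup] /size_poly1P [c c0 ->] ->; rewrite coefC /= unitfE.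
case: (classic (irreducible_poly p)) => [ip|nip].
  exists [:: p]; rewrite big_seq1; split=> // y; rewrite inE => /eqP -> {y}; split=> // a b [c ec].
  have /dvdpP : p %| a * b by apply/dvdpP; exists c.
  have [pa _|pa] := boolP (p %| a); first by left; move/dvdpP: pa.
  move=> _; right; apply/dvdpP; rewrite -(@Gauss_dvdpr _ b a p).
    by apply/dvdpP; exists c.
  rewrite /coprimep; apply: contraNT pa => g1.
  have /eqp_dvdl <- := ip.2 (gcdp p a) g1 (dvdp_gcdl p a).
  exact: dvdp_gcdr.
have [q [q1 qp nqp]] : exists q : {poly K}, [/\ size q != 1, q %| p & ~~ (q %= p)].
  apply: NNPP => no; apply: nip; split=> // q q1 qp.
  by apply: contraT => nqp; case: no; exists q.
have /dvdpP [r er] := qp.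
have [r0 q0] : r != 0 /\ q != 0 by apply/andP; rewrite -negb_or -mulf_eq0 -er.
have sq : (1 < size q)%N.
  by move: q1 q0; rewrite -size_poly_eq0; case: (size q) => [|[]].
have sr : (1 < size r)%N.
  have := size_poly_gt0 r; rewrite r0; case s: (size r) => [|[]] // _.
  move/eqP/size_poly1P: s => [c c0 e]; case/negP: nqp.
  by rewrite er e mul_polyC eqp_sym eqp_scale.
have szp : size p = (size r + size q).-1 by rewrite er size_mul.
have [|s [hs es]] := IH q _ q0; first by move: hn sq sr; rewrite szp; case: (size q) (size r) => [|x] [|y] //; rewrite ?addSn ?addnS /= ; lia.
have [|t [ht et]] := IH r _ r0; first by move: hn sq sr; rewrite szp; case: (size q) (size r) => [|x] [|y] //; rewrite ?addSn ?addnS /= ; lia.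
exists (t ++ s); rewrite big_cat er -et -es; split=> // y.
by rewrite mem_cat => /orP [/ht|/hs].
Qed.

(** If [p] divides [a * b], it divides one of the two leading coefficients; dropping that leading
    term preserves the divisibility and lowers the total size. *)
Lemma wprime_polyC (R : idomainType) (p : R) : wprime p -> wprime p%:P.
Proof.
move=> [p0 hp]; split=> [|a b]; first by rewrite polyC_eq0.
have [n] := ubnP (size a + size b); elim: n a b => // n IH a b hn.
have [->|a0] := eqVneq a 0; first by left; exists 0; rewrite mul0r.
have [->|b0] := eqVneq b 0; first by right; exists 0; rewrite mul0r.
move=> [c ec]; have /hp : pdvd p (lead_coef a * lead_coef b).
  by exists (lead_coef c); rewrite -lead_coefM ec lead_coefM lead_coefC.
have trunc (q : {poly R}) : q != 0 -> pdvd p (lead_coef q) -> exists d q',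
    q = d * p%:P + q' /\ (size q' < size q)%N.
  move=> q0 [d ed]; exists (d *: 'X^((size q).-1)), (q - lead_coef q *: 'X^((size q).-1)).
  split; first by rewrite ed -!mul_polyC polyCM; ring.
  have sq := size_poly_gt0 q; rewrite q0 in sq.
  apply: (@leq_ltn_trans (size q).-1); last by rewrite prednK.
  apply/leq_sizeP => j hj; rewrite coefB coefZ coefXn.
  have [->|jn] := eqVneq j (size q).-1; first by rewrite mulr1 subrr.
  rewrite mulr0 subr0 nth_default //; move: hj jn sq; case: (size q) => [|k] //=; lia.
case=> [/(trunc a a0)|/(trunc b b0)] [d [q [eq sq]]].
  have [||[w ew]|] := IH q b.
  - by move: hn sq; lia.
  - exists (c - d * b); rewrite mulrBl -ec eq; ring.
  - by left; exists (d + w); rewrite eq ew mulrDl.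
  - by right.
have [||h|[w ew]] := IH a q.
- by move: hn sq; lia.
- exists (c - d * a); rewrite mulrBl -ec eq; ring.
- by left.
- by right; exists (d + w); rewrite eq ew mulrDl.
Qed.

(** This count produces the bounds that Nagata's criterion requires in [S_bounded]. *)
Lemma wprime_count (R : idomainType) (l s : seq R) (u : R) : u \is a GRing.unit ->
  (forall y, y \in l -> wprime y /\ y \isn't a GRing.unit) ->
  (forall y, y \in s -> wprime y /\ y \isn't a GRing.unit) ->
  pdvd (\prod_(y <- l) y) (u * \prod_(y <- s) y) -> (size l <= size s)%N.
Proof.
elim: l s u => // y l IH s u uu hl hs; rewrite big_cons => -[c ec].
have [wy yu] : wprime y /\ y \isn't a GRing.unit by apply: hl; rewrite inE eqxx.
have [y0 hy] := wy.
have [||z zs [d ed]] := @wprime_prod R y s wy; first by rewrite pdvd1_unit; apply/negP.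
  by exists (u^-1 * c * \prod_(j <- l) j); apply: (mulrI uu); rewrite ec !mulrA divrr // mul1r; ring.
have [wz zu] := hs z zs.
have ud : d \is a GRing.unit.
  by have [_ _ /(_ _ _ ed) []] := wprime_irreducible wz zu => // h; rewrite h in yu.
rewrite (perm_size (perm_to_rem zs)) /= ltnS; apply: (IH _ (u * d)).
- by rewrite unitrM uu.
- by move=> w wl; apply: hl; rewrite inE wl orbT.
- by move=> w /mem_rem; apply: hs.
- exists c; apply: (mulfI y0); move: ec; rewrite (perm_big _ (perm_to_rem zs)) big_cons /= {1}ed => e.
  by transitivity (u * (d * y * \prod_(j <- rem z s) j)); [ring|rewrite e mulrCA].
Qed.

(* The fraction fields are abstract because conversion unfolds the operations of {fraction _}. *)
Section Gauss.
Variable R : idomainType.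
Hypothesis fR : factorial_ring R.
Variables (K L : fieldType) (frac : {rmorphism R -> K}) (toL : {rmorphism {poly K} -> L}).
Hypotheses (frac_inj : injective frac) (toL_inj : injective toL).
Hypothesis frac_rep : forall k, exists a b, b != 0 /\ k = frac a / frac b.

Let toK : {rmorphism {poly R} -> {poly K}} := map_poly frac.

Let frac_eq0 x : (frac x == 0) = (x == 0).
Proof. exact: inj_rmorph_eq0. Qed.

Definition prime_constant (x : {poly R}) :=
  exists c, [/\ wprime c, c \isn't a GRing.unit & x = c%:P].

Lemma common_denominator (p : {poly K}) :
  exists (c : R) (q : {poly R}), c != 0 /\ (frac c)%:P * p = map_poly frac q.
Proof.
elim/poly_ind: p => [|p k [c [q [c0 e]]]].
  by exists 1, 0; rewrite mulr0 rmorph0 oner_neq0.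
have [a [b [b0 ek]]] := frac_rep k.
exists (b * c), (b%:P * q * 'X + (a * c)%:P); split; first by rewrite mulf_neq0.
rewrite rmorphD !rmorphM /= !map_polyC map_polyX /= -e ek mulrDr.
have b0' : frac b != 0 by rewrite frac_eq0.
congr (_ + _); first by rewrite !mulrA.
by rewrite -!polyCM; congr polyC; field.
Qed.

(** Nagata's criterion with the prime constants inverted: the localization is [{poly K}], where
    nothing is left to invert, hence the empty [T]. Leading coefficients bound the number of prime
    constants dividing a polynomial. *)
Lemma poly_factorial_aux : factorial_ring {poly R}.
Proof.
apply: (@nagata _ {poly K} L (toL \o toK)%FUN toL _ _
  prime_constant (fun _ => False)).
- apply: inj_comp toL_inj _; exact: map_inj_poly frac_inj (rmorph0 _).
- exact: toL_inj.
- by move=> _ [c [wc cu ->]]; apply: wprime_polyC.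
- move=> _ [c [wc cu ->]]; rewrite pdvd1_unit poly_unitE coefC size_polyC /=.
  by rewrite (negbTE cu) andbF.
- move=> x x0; have lx : lead_coef x != 0 by rewrite lead_coef_eq0.
  have [u [s [uu hs e]]] := factorial_nonunit fR lx; exists (size s) => l hl [c ec].
  rewrite -(size_map lead_coef); apply: (wprime_count uu _ hs).
    by move=> _ /mapP [y /hl [d [wd du ->]] ->]; rewrite lead_coefC.
  rewrite -e ec lead_coefM; exists (lead_coef c); congr (_ * _).
  rewrite big_map; elim: l {hl ec} => [|y l IH]; rewrite ?big_nil ?lead_coefC //.
  by rewrite !big_cons lead_coefM IH.
- by [].
move=> l; split=> [[x [s [[t [ht ->]] e]]]|[p [s [[t [ht ->]] e]]]]; last first.
  case: t ht e => [ht|y t ht]; last by case: (ht y); rewrite inE eqxx.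
  rewrite big_nil rmorph1 mulr1 => {l}->.
  have [c [q [c0 eq]]] := common_denominator p.
  have [u [s' [uu hs e]]] := factorial_nonunit fR c0.
  (* The unit part [u] of the denominator is not a prime constant, so it moves to the numerator. *)
  exists (u^-1 *: q), (\prod_(y <- map polyC s') y); split.
    by exists (map polyC s'); split=> // _ /mapP [y /hs [wy yu] ->]; exists y.
  rewrite /= big_map -rmorph_prod -rmorphM; congr (toL _).
  have cu : frac u != 0.
    by rewrite frac_eq0; apply: contraTneq uu => ->; rewrite unitr0.
  apply: (@mulfI _ (frac u)%:P); first by rewrite polyC_eq0.
  have -> : (frac u)%:P * toK (u^-1 *: q) = toK q.
    by rewrite -mul_polyC rmorphM /= map_polyC mulrA -polyCM -rmorphM divrr // rmorph1 mul1r.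
  rewrite /toK /= map_polyC -eq e rmorphM polyCM -mulrA.
  by congr (_ * _); rewrite mulrC.
exists (toK x * (toK (\prod_(y <- t) y))^-1), 1.
have us : toK (\prod_(y <- t) y) \is a GRing.unit.
  rewrite rmorph_prod; elim: t ht {e} => [|y t IH] ht; first by rewrite big_nil unitr1.
  rewrite big_cons unitrM IH ?andbT; last by move=> z zt; apply: ht; rewrite inE zt orbT.
  have [c [[c0 _] _ ->]] : prime_constant y by apply: ht; rewrite inE eqxx.
  by rewrite /toK /= map_polyC poly_unitE size_polyC frac_eq0 c0 coefC /= unitfE frac_eq0.
split; first exact: prods1.
rewrite rmorph1 mulr1; apply: (@mulIf _ (toL (toK (\prod_(y <- t) y)))).
  by rewrite inj_rmorph_eq0 //; apply: contraTneq us => ->; rewrite unitr0.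
  by rewrite e -rmorphM divrK.
exact: poly_field_factorial.
Qed.

End Gauss.

Lemma poly_factorial (R : idomainType) : factorial_ring R -> factorial_ring {poly R}.
Proof.
move=> fR; apply: (poly_factorial_aux fR (@tofrac_inj R) (@tofrac_inj {poly {fraction R}})).
exact: fraction_rep.
Qed.


(** * Polynomials in several variables *)

Lemma mpoly_gen_ind (n : nat) (R : comNzRingType) (Q : {mpoly R[n]} -> Prop) :
  (forall c, Q c%:MP) -> (forall i, Q 'X_i) ->
  (forall p q, Q p -> Q q -> Q (p + q)) -> (forall p q, Q p -> Q q -> Q (p * q)) ->
  forall p, Q p.
Proof.
move=> QC QX QD QM; elim/mpolyind => [|c m p _ _ Qp]; first by rewrite -mpolyC0.
apply: (QD) => //; rewrite -mul_mpolyC; apply: (QM) => //.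
rewrite mpolyXE_id; apply: (big_ind Q) => [|//|i _]; first by rewrite -mpolyC1; apply: QC.
elim: (m i) => [|k IH]; first by rewrite expr0 -mpolyC1; apply: QC.
by rewrite exprS; apply: QM.
Qed.

Lemma mpoly_rmorph_ext (n : nat) (R S : comNzRingType) (f g : {rmorphism {mpoly R[n]} -> S}) :
  (forall c, f c%:MP = g c%:MP) -> (forall i, f 'X_i = g 'X_i) -> f =1 g.
Proof.
move=> eC eX; elim/mpoly_gen_ind => // p q ep eq; first by rewrite !rmorphD ep eq.
by rewrite !rmorphM ep eq.
Qed.

Section MpolySucc.
Variables (n : nat) (R : idomainType).

(** Variable 0 becomes the outer one. With its inverse [mpoly_fold], the resulting morphism carries
    the univariate results to several variables by induction. *)
Definition mpoly_unfold_var (i : 'I_n.+1) : {poly {mpoly R[n]}} :=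
  if unlift ord0 i is Some j then ('X_j)%:P else 'X.

Definition mpoly_unfold : {rmorphism {mpoly R[n.+1]} -> {poly {mpoly R[n]}}} :=
  mmap (polyC \o @mpolyC n R) mpoly_unfold_var.

Definition mpoly_weaken : {rmorphism {mpoly R[n]} -> {mpoly R[n.+1]}} :=
  mmap (@mpolyC n.+1 R) (fun j => 'X_(lift ord0 j)).

Lemma mpoly_fold_comm : commr_rmorph mpoly_weaken ('X_ord0 : {mpoly R[n.+1]}).
Proof. by move=> x; apply: mulrC. Qed.

Definition mpoly_fold : {rmorphism {poly {mpoly R[n]}} -> {mpoly R[n.+1]}} :=
  horner_morph mpoly_fold_comm.

Lemma mpoly_unfoldC c : mpoly_unfold c%:MP = (c%:MP)%:P.
Proof. by rewrite /mpoly_unfold /= mmapC. Qed.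

Lemma mpoly_unfoldX i : mpoly_unfold 'X_i = mpoly_unfold_var i.
Proof. by rewrite /mpoly_unfold /= mmapX mmap1U. Qed.

Lemma mpoly_foldC p : mpoly_fold p%:P = mpoly_weaken p.
Proof. exact: horner_morphC. Qed.

Lemma mpoly_unfoldK : cancel mpoly_unfold mpoly_fold.
Proof.
apply: (@mpoly_rmorph_ext _ _ _ (mpoly_fold \o mpoly_unfold)%FUN idfun) => [c|i] /=.
  by rewrite mpoly_unfoldC mpoly_foldC /mpoly_weaken /= mmapC.
rewrite mpoly_unfoldX /mpoly_unfold_var; case: unliftP => [j ->|->].
  by rewrite mpoly_foldC /mpoly_weaken /= mmapX mmap1U.
exact: horner_morphX.
Qed.

Lemma mpoly_foldK : cancel mpoly_fold mpoly_unfold.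
Proof.
have wk : mpoly_unfold \o mpoly_weaken =1 polyC.
  apply: (@mpoly_rmorph_ext _ _ _ (mpoly_unfold \o mpoly_weaken)%FUN polyC) => [c|i] /=.
    by rewrite /mpoly_weaken /= mmapC -mpoly_unfoldC.
  by rewrite /mpoly_weaken /= mmapX mmap1U mpoly_unfoldX /mpoly_unfold_var liftK.
elim/poly_ind => [|p c IH]; first by rewrite !rmorph0.
rewrite !rmorphD !rmorphM /= IH mpoly_foldC -[X in _ + X = _]/((mpoly_unfold \o mpoly_weaken) c) wk.
by rewrite [mpoly_fold 'X]horner_morphX mpoly_unfoldX /mpoly_unfold_var unlift_none.
Qed.

End MpolySucc.

Lemma mpoly_factorial n (R : idomainType) : factorial_ring R -> factorial_ring {mpoly R[n]}.
Proof.
move=> fR; elim: n => [|n IH].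
  apply: (@factorial_bij _ _ (mcoeff 0%MM : {rmorphism {mpoly R[0]} -> R}) (@mpolyC 0 R)) => //.
    by move=> p; rewrite [p in RHS]nvar0_mpolyC.
  exact: mpolyCK.
exact: factorial_bij (@mpoly_unfoldK n R) (@mpoly_foldK n R) (poly_factorial IH).
Qed.

Lemma wprime_mpolyC n (R : idomainType) (p : R) : wprime p -> wprime (p%:MP : {mpoly R[n]}).
Proof.
move=> wp; elim: n => [|n IH].
  apply: (@wprime_bij _ _ (mcoeff 0%MM : {rmorphism {mpoly R[0]} -> R}) (@mpolyC 0 R)) => //.
    by move=> q; rewrite [q in RHS]nvar0_mpolyC.
  exact: mpolyCK.
have := wprime_bij (@mpoly_unfoldK n R) (@mpoly_foldK n R) (wprime_polyC IH).
by rewrite mpoly_foldC /mpoly_weaken /= mmapC.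
Qed.

(** * Laurent monomials and twists of graded rings *)

Lemma exprz_closed (L : fieldType) (Q : L -> Prop) x (z : int) : Q 1 ->
  (forall a b, Q a -> Q b -> Q (a * b)) -> Q x -> Q x^-1 -> Q (x ^ z).
Proof.
move=> Q1 QM Qx Qv.
have Qn y n : Q y -> Q (y ^+ n).
  by move=> Qy; elim: n => [|n IH]; rewrite ?expr0 ?exprS //; apply: QM.
case: z => n; first by rewrite -exprnP; apply: Qn.
by rewrite NegzE -exprnN -exprVn; apply: Qn.
Qed.

Section Monomials.
Variables (L : fieldType) (N : nat).
Implicit Types (x : 'I_N -> L) (u v : 'rV[int]_N).

Definition monz x v := \prod_i x i ^ v 0 i.

Lemma monzD x u v : (forall i, x i != 0) -> monz x (u + v) = monz x u * monz x v.
Proof.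
move=> x0; rewrite /monz -big_split; apply: eq_bigr => i _.
by rewrite mxE expfzDr.
Qed.

Lemma monz_neq0 x v : (forall i, x i != 0) -> monz x v != 0.
Proof. by move=> x0; apply/prodf_neq0 => i _; apply: expfz_neq0. Qed.

Lemma monz_delta x i : monz x (delta_mx 0 i) = x i.
Proof.
rewrite /monz (bigD1 i) //= mxE !eqxx /= expr1z big1 ?mulr1 // => j ji.
by rewrite mxE (negbTE ji) /= expr0z.
Qed.

Lemma exprz_prod (x : L) (I : Type) (r : seq I) (z : I -> int) : x != 0 ->
  x ^ (\sum_(i <- r) z i) = \prod_(i <- r) x ^ z i.
Proof.
move=> x0; elim: r => [|i r IH]; first by rewrite !big_nil expr0z.
by rewrite !big_cons expfzDr // IH.
Qed.

Lemma prod_exprz (I : Type) (r : seq I) (F : I -> L) (k : int) :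
  (\prod_(i <- r) F i) ^ k = \prod_(i <- r) F i ^ k.
Proof.
elim: r => [|i r IH]; first by rewrite !big_nil exp1rz.
by rewrite !big_cons expfzMl IH.
Qed.

Lemma monz_mulmx x (K : nat) (M : 'M[int]_(K, N)) (w : 'rV[int]_K) :
  (forall i, x i != 0) ->
  \prod_k (monz x (row k M)) ^ w 0 k = monz x (w *m M).
Proof.
move=> x0; rewrite /monz; under eq_bigr do rewrite prod_exprz.
rewrite exchange_big; apply: eq_bigr => i _ /=.
rewrite mxE exprz_prod //; apply: eq_bigr => k _.
by rewrite mxE -exprz_exp [RHS]exprzAC.
Qed.

Lemma monz_closed (Q : L -> Prop) x v : Q 1 -> (forall a b, Q a -> Q b -> Q (a * b)) ->
  (forall i, Q (x i)) -> (forall i, Q (x i)^-1) -> Q (monz x v).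
Proof.
by move=> Q1 QM Qx Qv; apply: (big_ind Q) => // i _; apply: exprz_closed.
Qed.

End Monomials.

Lemma monz_rows (L : fieldType) N K (x : 'I_N -> L) (M : 'M[int]_(K, N)) (w : 'rV[int]_K) :
  (forall i, x i != 0) -> monz (fun k => monz x (row k M)) w = monz x (w *m M).
Proof. exact: monz_mulmx. Qed.

Lemma monz_recl (L : fieldType) N (x : 'I_N.+1 -> L) v :
  monz x v = x 0 ^ v 0 0 * \prod_i x (lift 0 i) ^ v 0 (lift 0 i).
Proof. by rewrite /monz big_ord_recl. Qed.

Definition primitive N (v : 'rV[int]_N) :=
  forall d : nat, (forall i, (d %| `|v 0%R i|)%N) -> d = 1%N.

(** The Smith form of a single row is a multiple [z] of the first unit vector. This [z] divides
    every entry of [v], so primitivity forces it to be 1 or -1. *)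
Lemma unimodular_completion N (v : 'rV[int]_N.+1) : primitive v ->
  exists2 M : 'M[int]_N.+1, M \in unitmx & v *m M = delta_mx 0 0.
Proof.
move=> pv; have [U uU [R uR [d _ e]]] := int_Smith_normal_form v.
pose z := U 0 0 * d`_0.
have eD : U *m (\matrix_(i, j) (d`_i *+ (i == j :> nat))) = z *: delta_mx 0 0 :> 'M[int]_(1, N.+1).
  apply/matrixP => i j; rewrite !ord1 !mxE big_ord1 !mxE /z.
  by case: j => -[|j] hj; rewrite /= ?mulr1n ?mulr0n ?mulr1 ?mulr0.
rewrite eD in e.
have z1 : `|z|%N = 1%N.
  apply: pv => i; rewrite e -scalemxAl mxE abszM; exact: dvdn_mulr.
have zz : z * z = 1.
  by case: (z) z1 => [[|[]]|[|]].
exists (z *: invmx R); first by rewrite unitmxZ ?unitmx_inv //; apply/unitrP; exists z.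
by rewrite e -scalemxAr -!scalemxAl mulmxK // scalerA zz scale1r.
Qed.

(** * Constructing ring morphisms *)

Lemma rmorphism_of (R S : pzRingType) (f : R -> S) :
  (forall x y, f (x + y) = f x + f y) -> (forall x y, f (x * y) = f x * f y) -> f 1 = 1 ->
  exists g : {rmorphism R -> S}, forall x, g x = f x.
Proof.
move=> fD fM f1.
have f0 : f 0 = 0 by apply: (addrI (f 0)); rewrite -fD !addr0.
have fB : zmod_morphism f.
  by move=> x y; apply: (addIr (f y)); rewrite -fD !subrK.
pose a := GRing.isZmodMorphism.Build R S f fB.
pose m := GRing.isMonoidMorphism.Build R S f (conj f1 fM).
pose g : {rmorphism R -> S} := HB.pack f a m.
by exists g.
Qed.

(** [B] is known only through a surjection, so values are read at chosen preimages; the kernel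
    condition makes the choice immaterial. *)
Lemma rmorphism_factor (P B S : pzRingType) (phi : {rmorphism P -> B})
    (psi : {rmorphism P -> S}) :
  (forall b, exists p, phi p = b) -> (forall p, phi p = 0 -> psi p = 0) ->
  exists f : {rmorphism B -> S}, forall p, f (phi p) = psi p.
Proof.
move=> surj ker; pose s b := proj1_sig (constructive_indefinite_description _ (surj b)).
have sK b : phi (s b) = b by rewrite /s; case: constructive_indefinite_description.
have eq_psi p q : phi p = phi q -> psi p = psi q.
  move=> e; apply/eqP; rewrite -subr_eq0 -rmorphB; apply/eqP/ker.
  by rewrite rmorphB e subrr.
have [|||f ef] := @rmorphism_of B S (psi \o s).
- by move=> x y /=; rewrite -rmorphD; apply: eq_psi; rewrite rmorphD !sK.
- by move=> x y /=; rewrite -rmorphM; apply: eq_psi; rewrite rmorphM !sK.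
- by rewrite /= -(rmorph1 psi); apply: eq_psi; rewrite sK rmorph1.
by exists f => p; rewrite ef; apply: eq_psi; rewrite sK.
Qed.

Lemma rmorphism_extend (B : idomainType) (E L : fieldType) (i : {rmorphism B -> E})
    (f : {rmorphism B -> L}) :
  injective i -> injective f -> (forall k, exists a b, b != 0 /\ k = i a / i b) ->
  exists g : {rmorphism E -> L}, forall b, g (i b) = f b.
Proof.
move=> i_inj f_inj rep.
pose n k := proj1_sig (constructive_indefinite_description _ (rep k)).
have hn k : exists b, b != 0 /\ k = i (n k) / i b.
  by rewrite /n; case: constructive_indefinite_description.
pose d k := proj1_sig (constructive_indefinite_description _ (hn k)).
have d0 k : d k != 0 by rewrite /d; case: constructive_indefinite_description => ? [].
have ek k : k = i (n k) / i (d k).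
  by rewrite /d; case: constructive_indefinite_description => ? [].
have id0 k : i (d k) != 0 by rewrite inj_rmorph_eq0.
have fd0 k : f (d k) != 0 by rewrite inj_rmorph_eq0.
pose g k := f (n k) / f (d k).
(* Any representation as a quotient computes [g], not only the chosen one. *)
have ge k x y : y != 0 -> k * i y = i x -> g k = f x / f y.
  move=> y0 e; have fy0 : f y != 0 by rewrite inj_rmorph_eq0.
  apply/eqP; rewrite /g eqr_div // -!rmorphM; apply/eqP; congr (f _).
  by apply: i_inj; rewrite !rmorphM -e {2}(ek k); field.
have gK k : k * i (d k) = i (n k) by rewrite {1}(ek k) divfK.
have [|||h eh] := @rmorphism_of E L g.
- move=> x y; rewrite (ge (x + y) (n x * d y + n y * d x) (d x * d y)) ?mulf_neq0 //.
    by rewrite /g rmorphD !rmorphM; field; rewrite !fd0.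
  by rewrite rmorphD !rmorphM -!gK; ring.
- move=> x y; rewrite (ge (x * y) (n x * n y) (d x * d y)) ?mulf_neq0 //.
    by rewrite /g !rmorphM; field; rewrite !fd0.
  by rewrite !rmorphM -!gK; ring.
- by rewrite (ge 1 1 1) ?oner_neq0 // ?rmorph1 ?divr1 // mulr1.
by exists h => b; rewrite eh (ge _ b 1) ?oner_neq0 ?rmorph1 ?mulr1 ?divr1.
Qed.

(** * Graded domains and twisted morphisms *)

Section Grading.
Variables (A : idomainType) (G : int -> A -> Prop).
Hypothesis gr : Zgrading G.

Lemma grade0 i : G i 0.
Proof. by have [/(_ i) []] := gr. Qed.

Lemma gradeB i x y : G i x -> G i y -> G i (x - y).
Proof. by have [/(_ i) [_ h] _ _ _] := gr; apply: h. Qed.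

Lemma gradeN i x : G i x -> G i (- x).
Proof. by move=> h; rewrite -sub0r; apply: gradeB => //; apply: grade0. Qed.

Lemma gradeD i x y : G i x -> G i y -> G i (x + y).
Proof. by move=> hx hy; rewrite -[y]opprK; apply/gradeB/gradeN. Qed.

Lemma gradeM i j x y : G i x -> G j y -> G (i + j) (x * y).
Proof. by have [_ h _ _] := gr; apply: h. Qed.

Lemma grade_sum (I : Type) (r : seq I) (Q : pred I) (F : I -> A) i :
  (forall x, Q x -> G i (F x)) -> G i (\sum_(x <- r | Q x) F x).
Proof. by move=> h; apply: (big_ind (G i)) => //; [exact: grade0|move=> *; exact: gradeD]. Qed.

Lemma grade_uniq (s : seq int) (f : int -> A) : uniq s -> (forall i, G i (f i)) ->
  \sum_(i <- s) f i = 0 -> forall i, i \in s -> f i = 0.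
Proof. by have [_ _ _ h] := gr; apply: h. Qed.

Lemma grade_decomp (a : A) : exists (s : seq int) (f : int -> A),
  [/\ uniq s, (forall i, G i (f i)) & a = \sum_(i <- s) f i].
Proof. by have [_ _ h _] := gr; apply: h. Qed.

(** Multiplying a decomposition of 1 by [x] must give back [x], which lives in degree [i]; so the
    components of 1 outside degree 0 vanish. *)
Lemma grade_one i x : G i x -> x != 0 -> G 0 1.
Proof.
move=> hx x0; have [s [f [us hf e1]]] := grade_decomp 1.
pose s' := undup (0 :: s); pose f' k := if k \in s then f k else 0.
have hf' k : G k (f' k) by rewrite /f'; case: ifP => _ //; exact: grade0.
have e1' : 1 = \sum_(k <- s') f' k.
  rewrite e1 /f' -big_mkcond -[RHS]big_filter; apply: perm_big.
  apply: uniq_perm => [//||k]; first by rewrite filter_uniq // undup_uniq.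
  by rewrite mem_filter mem_undup inE; case: (k \in s); rewrite ?orbT.
have zs' : 0 \in s' by rewrite mem_undup inE eqxx.
pose g k := x * f' (k - i) - (if k == i then x else 0).
have hg k : G k (g k).
  apply: gradeB; last by case: eqP => [->|_] //; apply: grade0.
  by rewrite -[k in G k _](subrKC i); apply: gradeM.
have sum0 : \sum_(k <- map (+%R i) s') g k = 0.
  rewrite big_map sumrB (eq_bigr (fun k => x * f' k)) => [|k _]; last by rewrite addrC addKr.
  rewrite -mulr_sumr -e1' mulr1 -big_mkcond /= (eq_bigl (fun k => k == 0)) => [|k].
    by rewrite -big_filter filter_pred1_uniq ?undup_uniq // big_seq1 subrr.
  by rewrite -{2}(addr0 i) (inj_eq (addrI i)).
have us' : uniq (map (+%R i) s') by rewrite (map_inj_uniq (addrI i)) undup_uniq.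
rewrite e1' big_seq; apply: grade_sum => k ks.
have [->|k0] := eqVneq k 0; first exact: hf'.
have := grade_uniq us' hg sum0 (map_f _ ks).
rewrite /g -{4}(addr0 i) (inj_eq (addrI i)) (negbTE k0) subr0 addrC addKr.
by move/eqP; rewrite mulf_eq0 (negbTE x0) => /eqP ->; apply: grade0.
Qed.

Lemma sum_by_first (V : nmodType) (s : seq (int * A)) (F : int * A -> V) :
  \sum_(x <- s) F x = \sum_(i <- undup (map fst s)) \sum_(x <- s | x.1 == i) F x.
Proof.
rewrite (exchange_big_dep xpredT) //= [LHS]big_seq [RHS]big_seq.
apply: eq_bigr => x xs; under eq_bigl do rewrite eq_sym.
rewrite -big_filter (filter_pred1_uniq (undup_uniq _)) ?big_seq1 //.
by rewrite mem_undup map_f.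
Qed.

Section Twist.
Variables (S : comNzRingType) (iota : {rmorphism A -> S}) (chi : int -> S).
Hypothesis chi0 : chi 0 = 1.
Hypothesis chiD : forall i j a b, G i a -> G j b -> a != 0 -> b != 0 ->
  chi (i + j) = chi i * chi j.
Hypothesis has_one : G 0 1.

Let homl (s : seq (int * A)) := forall x, x \in s -> G x.1 x.2.
Let total (s : seq (int * A)) := \sum_(x <- s) x.2.
Let tw (s : seq (int * A)) := \sum_(x <- s) iota x.2 * chi x.1.

Let tw_total0 s : homl s -> total s = 0 -> tw s = 0.
Proof.
move=> hs; rewrite /total /tw !sum_by_first => e.
set f := fun i => \sum_(x <- s | x.1 == i) x.2.
have hf i : G i (f i).
  by rewrite /f big_seq_cond; apply: grade_sum => x /andP [/hs h /eqP <-].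
have f0 := grade_uniq (undup_uniq (map fst s)) hf e.
rewrite big_seq big1 // => i /f0 fi0.
rewrite (eq_bigr (fun x => iota x.2 * chi i)) => [|x /eqP -> //].
by rewrite -mulr_suml -rmorph_sum -/(f i) fi0 rmorph0 mul0r.
Qed.

Let exl a : exists s, homl s /\ total s = a.
Proof.
have [s [f [us hf e]]] := grade_decomp a.
exists (map (fun i => (i, f i)) s); split; last by rewrite /total big_map e.
by move=> _ /mapP [i _ ->]; apply: hf.
Qed.

Let negl (s : seq (int * A)) := map (fun x => (x.1, - x.2)) s.

Let tw_eq s t : homl s -> homl t -> total s = total t -> tw s = tw t.
Proof.
move=> hs ht e; have : tw (s ++ negl t) = 0.
  apply: tw_total0.
    move=> x; rewrite mem_cat => /orP [/hs //|/mapP [y /ht yt ->]]; exact: gradeN.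
  by rewrite /total big_cat /= big_map sumrN -/(total t) -e subrr.
rewrite /tw big_cat /= big_map; under [X in _ + X]eq_bigr do rewrite rmorphN mulNr.
by rewrite sumrN => /eqP; rewrite subr_eq0 => /eqP.
Qed.

Lemma twist_exists : exists tau : {rmorphism A -> S},
  forall i a, G i a -> tau a = iota a * chi i.
Proof.
pose l a := proj1_sig (constructive_indefinite_description _ (exl a)).
have [hl tl] : (forall a, homl (l a)) /\ (forall a, total (l a) = a).
  by split=> a; rewrite /l; case: constructive_indefinite_description => ? [].
have key s a : homl s -> total s = a -> tw (l a) = tw s.
  by move=> hs e; apply: tw_eq => //; rewrite tl.
have tw_hom i a : G i a -> tw (l a) = iota a * chi i.
  move=> h; rewrite (key [:: (i, a)]); first by rewrite /tw big_seq1.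
    by move=> x; rewrite inE => /eqP ->.
  by rewrite /total big_seq1.
have [|||tau etau] := @rmorphism_of A S (fun a => tw (l a)).
- move=> x y; rewrite (key (l x ++ l y)); first by rewrite /tw big_cat.
    by move=> z; rewrite mem_cat => /orP [/hl|/hl].
  by rewrite /total big_cat -/(total _) -/(total _) !tl.
- move=> x y.
  pose s := [seq (a.1 + b.1, a.2 * b.2) | a <- l x, b <- l y].
  rewrite (key s).
  + rewrite /tw /s big_allpairs_dep mulr_suml !big_seq; apply: eq_bigr => a ax.
    rewrite mulr_sumr !big_seq; apply: eq_bigr => b bY /=.
    have [->|a0] := eqVneq a.2 0; first by rewrite mul0r !rmorph0 !mul0r.
    have [->|b0] := eqVneq b.2 0; first by rewrite mulr0 !rmorph0 !mul0r mulr0.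
    by rewrite (chiD (hl _ _ ax) (hl _ _ bY) a0 b0) rmorphM mulrACA.
  + by move=> _ /allpairsPdep [a [b [ax bY ->]]]; apply: gradeM; [exact: hl ax|exact: hl bY].
  + by rewrite /total /s big_allpairs_dep /= -[x in RHS]tl -[y in RHS]tl /total big_distrlr.
- by rewrite (tw_hom 0) // rmorph1 chi0 mulr1.
by exists tau => i a h; rewrite etau; apply: tw_hom.
Qed.

Lemma twist_mpoly n (x : 'I_n -> S) : exists psi : {rmorphism {mpoly A[n]} -> S},
  (forall i a, G i a -> psi a%:MP = iota a * chi i) /\ (forall j, psi 'X_j = x j).
Proof.
have [tau htau] := twist_exists; exists (mmap tau x); split=> [i a h|j] /=.
  by rewrite mmapC; apply: htau.
by rewrite mmapX mmap1U.
Qed.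

End Twist.

Lemma grade_gen_ind n (Q : {mpoly A[n]} -> Prop) :
  (forall i a, G i a -> Q a%:MP) -> (forall i, Q 'X_i) ->
  (forall p q, Q p -> Q q -> Q (p + q)) -> (forall p q, Q p -> Q q -> Q (p * q)) ->
  forall p, Q p.
Proof.
move=> QG QX QD QM; apply: mpoly_gen_ind => // c.
have [s [f [_ hf ->]]] := grade_decomp c; rewrite rmorph_sum /=.
apply: (big_ind Q) => // [|i _]; last exact: QG (hf i).
by rewrite -mpolyC0; apply: QG (grade0 0).
Qed.

End Grading.

(** * Primality of the binomial *)

Section Reduction.
Variables (A : idomainType) (F : A) (n : nat) (e : 'I_n.+1 -> nat).
Hypothesis e_gt0 : forall i, (1 <= e i)%N.

Definition em : 'X_{1..n.+1} := [multinom e i | i < n.+1].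
Definition gpol : {mpoly A[n.+1]} := \prod_(i < n.+1) 'X_i ^+ e i - F%:MP.

Lemma gpolE : gpol = 'X_[em] - F%:MP.
Proof. by rewrite /gpol mpolyXE_id; congr (_ - _); apply: eq_bigr => i _; rewrite mnmE. Qed.

Definition reduced (p : {mpoly A[n.+1]}) := forall m, (em <= m)%MM -> p@_m = 0.

Lemma mnm_divmod (m : 'X_{1..n.+1}) :
  exists r m', m = (m' + em *+ r)%MM /\ ~~ (em <= m')%MM.
Proof.
have [k] := ubnP (m ord0); elim: k m => // k IH m hk.
have [le|nle] := boolP (em <= m)%MM; last by exists 0, m; rewrite mulm0n addm0.
have [|r [m' [er nle]]] := IH (m - em)%MM.
  have := mnm_lepP le ord0; rewrite !mnmE; have := e_gt0 ord0; move: hk; lia.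
by exists r.+1, m'; rewrite mulmSr addmA -er submK.
Qed.

Lemma reduce (i : 'I_n.+1) (k : nat) (q : {mpoly A[n.+1]}) : exists p,
  [/\ reduced p, pdvd gpol (q * 'X_i ^+ k - p) &
      forall (m : 'X_{1..n.+1}) j, (j * e i + m i <= k)%N -> pdvd (F ^+ j) p@_m].
Proof.
elim/mpolyind: q => [|c m0 q _ _ [p [rp [d ed] hp]]].
  exists 0; rewrite mul0r subrr; split.
  - by move=> m _; rewrite mcoeff0.
  - by exists 0; rewrite mul0r.
  - by move=> m j _; exists 0; rewrite mcoeff0 mul0r.
have [r [m' [em' nle]]] := mnm_divmod (m0 + U_(i) *+ k)%MM.
exists ((c * F ^+ r) *: 'X_[m'] + p); split.
- move=> m le; rewrite mcoeffD mcoeffZ mcoeffX rp // addr0.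
  by case: eqP => [e'|_]; [rewrite e' le in nle|rewrite mulr0].
- have eX : 'X_[m0] * 'X_i ^+ k = 'X_[m'] * 'X_[em] ^+ r :> {mpoly A[n.+1]}.
    by rewrite !mpolyXn -!mpolyXD em'.
  exists (c%:MP * 'X_[m'] * (\sum_(j < r) 'X_[em] ^+ (r.-1 - j) * F%:MP ^+ j) + d).
  rewrite [RHS]mulrDl -ed gpolE.
  have -> : (c *: 'X_[m0] + q) * 'X_i ^+ k - ((c * F ^+ r) *: 'X_[m'] + p) =
     c%:MP * 'X_[m'] * ('X_[em] ^+ r - F%:MP ^+ r) + (q * 'X_i ^+ k - p).
    rewrite -!mul_mpolyC mpolyCM rmorphXn /=.
    transitivity (c%:MP * ('X_[m0] * 'X_i ^+ k) + q * 'X_i ^+ k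
                  - (c%:MP * F%:MP ^+ r * 'X_[m'] + p)); first by ring.
    by rewrite eX; ring.
  by rewrite subrXX; ring.
- move=> m j hj; rewrite mcoeffD mcoeffZ mcoeffX.
  have [w ew] := hp m j hj; case: eqP => [emm|_]; last by exists w; rewrite mulr0 add0r.
  have jr : (j <= r)%N.
    have := congr1 (fun t : 'X_{1..n.+1} => t i) em'.
    rewrite !mnmDE !mulmnE !mnmE eqxx mul1n emm => e1.
    rewrite leqNgt; apply/negP => rj; move: hj e1 (e_gt0 i); nia.
  exists (c * F ^+ (r - j) + w); rewrite mulr1 ew mulrDl -mulrA -exprD subnK //.
Qed.

Lemma reducedB p q : reduced p -> reduced q -> reduced (p - q).
Proof. by move=> hp hq m le; rewrite mcoeffB hp ?hq ?subr0. Qed.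

End Reduction.

Section LaurentIndependence.
Variables (K L : fieldType) (n : nat) (kap : {rmorphism {mpoly K[n]} -> L}).
Hypothesis kap_inj : injective kap.

Definition yvar (k : 'I_n) : L := kap 'X_k.

Lemma yvar_neq0 k : yvar k != 0.
Proof.
rewrite inj_rmorph_eq0 //; apply/eqP => /(congr1 (mcoeff U_(k)%MM)).
by rewrite mcoeffX eqxx mcoeff0; apply/eqP/oner_neq0.
Qed.

Lemma laurent_indep (I : eqType) (s : seq I) (v : I -> 'rV[int]_n) (k : I -> K) :
  uniq s -> {in s &, injective v} ->
  \sum_(x <- s) kap (k x)%:MP * monz yvar (v x) = 0 -> forall x, x \in s -> k x = 0.
Proof.
move=> us vinj e0 x0 x0s.
pose N := (\sum_(x <- s) \sum_i `|v x 0%R i|)%N.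
have hN x i : x \in s -> (0 <= v x 0 i + N%:Z)%R.
  move=> xs; have : (`|v x 0%R i| <= N)%N.
    rewrite /N (perm_big _ (perm_to_rem xs)) big_cons (bigD1 i) //=; lia.
  lia.
pose m x : 'X_{1..n} := [multinom `|(v x 0 i + N%:Z)%R|%N | i < n].
have eqm x : x \in s -> monz yvar (v x) * monz yvar (const_mx N%:Z) = kap 'X_[m x].
  move=> xs; rewrite -monzD; last exact: yvar_neq0.
  rewrite mpolyXE_id rmorph_prod; apply: eq_bigr => i _.
  by rewrite !mxE rmorphXn mnmE /= exprnP gez0_abs // hN.
have : \sum_(x <- s) kap (k x)%:MP * kap 'X_[m x] = 0.
  transitivity ((\sum_(x <- s) kap (k x)%:MP * monz yvar (v x)) * monz yvar (const_mx N%:Z)); last by rewrite e0 mul0r.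
  rewrite mulr_suml [LHS]big_seq [RHS]big_seq.
  by apply: eq_bigr => x xs; rewrite -mulrA eqm.
under eq_bigr do rewrite -rmorphM mul_mpolyC.
rewrite -rmorph_sum => /eqP; rewrite inj_rmorph_eq0 // => /eqP /(congr1 (mcoeff (m x0))).
rewrite mcoeff0 raddf_sum (perm_big _ (perm_to_rem x0s)) big_cons /= mcoeffZ mcoeffX eqxx mulr1.
rewrite big_seq big1 ?addr0 // => x; rewrite mem_rem_uniq // inE => /andP [xx0 xs].
rewrite mcoeffZ mcoeffX; case: eqP => [em|]; last by rewrite mulr0.
case/eqP: xx0; apply: vinj => //; apply/rowP => i.
have := congr1 (fun t : 'X_{1..n} => t i) em; rewrite !mnmE.
have := hN x i xs; have := hN x0 i x0s; lia.
Qed.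

End LaurentIndependence.

Definition ocons (T : Type) (n : nat) (x : T) (y : 'I_n -> T) (i : 'I_n.+1) : T :=
  if unlift ord0 i is Some j then y j else x.

Lemma ocons0 (T : Type) n (x : T) (y : 'I_n -> T) : ocons x y ord0 = x.
Proof. by rewrite /ocons unlift_none. Qed.

Lemma oconsS (T : Type) n (x : T) (y : 'I_n -> T) j : ocons x y (lift ord0 j) = y j.
Proof. by rewrite /ocons liftK. Qed.

Lemma ocons_all (T : Type) n (Q : T -> Prop) (x : T) (y : 'I_n -> T) :
  Q x -> (forall j, Q (y j)) -> forall i, Q (ocons x y i).
Proof. by move=> Qx Qy i; rewrite /ocons; case: unlift. Qed.

(* The exponent vector of [Z^e s^(-m)], where the index 0 stands for [s]. *)
Definition relrow (n : nat) (e : 'I_n -> nat) (m : int) : 'rV[int]_n.+1 :=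
  \row_i ocons (- m) (fun j => (e j)%:Z) i.

Lemma primitive_relrow n (e : 'I_n -> nat) (m : int) :
  gcdn (\big[gcdn/0%N]_(i < n) e i) `|m|%N = 1%N -> primitive (relrow e m).
Proof.
move=> h d hd; apply/eqP; rewrite -dvdn1 -h dvdn_gcd; apply/andP; split.
  by apply/dvdn_biggcdP => j _; have := hd (lift ord0 j); rewrite mxE oconsS.
by have := hd ord0; rewrite mxE ocons0 abszN.
Qed.

Lemma monz_relrow (L : fieldType) n (x : 'I_n.+1 -> L) (e : 'I_n -> nat) m :
  monz x (relrow e m) = x ord0 ^ (- m) * \prod_j x (lift ord0 j) ^+ e j.
Proof.
rewrite monz_recl mxE ocons0; congr (_ * _); apply: eq_bigr => j _.
by rewrite mxE oconsS.
Qed.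

Section Coefficients.
Variables (A : idomainType) (K L : fieldType) (N : nat) (frac : {rmorphism A -> K}).
Variable kap : {rmorphism {mpoly K[N]} -> L}.
Hypotheses (frac_inj : injective frac) (kap_inj : injective kap).

Definition embed : {rmorphism A -> L} := (kap \o (@mpolyC N K \o frac))%FUN.
Definition mpoly_embed : {rmorphism {mpoly A[N]} -> L} := (kap \o map_mpoly frac)%FUN.

Lemma embed_inj : injective embed.
Proof. by move=> x y /kap_inj /= /eqP; rewrite mpolyC_eq => /eqP; apply: frac_inj. Qed.

Lemma mpoly_embedC a : mpoly_embed a%:MP = embed a.
Proof. by rewrite /mpoly_embed /= map_mpolyC. Qed.

Lemma mpoly_embedX k : mpoly_embed 'X_k = yvar kap k.
Proof. by rewrite /mpoly_embed /= map_mpolyX. Qed.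

Lemma mpoly_embed_inj : injective mpoly_embed.
Proof.
move=> p q /kap_inj /mpolyP h; apply/mpolyP => m.
by have := h m; rewrite !mcoeff_map_mpoly => /frac_inj.
Qed.

End Coefficients.

Section Embedding.
Variables (A : idomainType) (G : int -> A -> Prop) (omega : int) (F : A).
Variables (n : nat) (e : 'I_n.+1 -> nat).
Hypotheses (gr : Zgrading G) (GF : G omega F) (F_neq0 : F != 0).
Hypothesis e_gt0 : forall i, (1 <= e i)%N.
Variables (K L : fieldType) (frac : {rmorphism A -> K}).
Variable kap : {rmorphism {mpoly K[n.+1]} -> L}.
Hypotheses (frac_inj : injective frac) (kap_inj : injective kap).
Variable M : 'M[int]_n.+2.
Hypotheses (M_unit : M \in unitmx) (M_rel : relrow e omega *m M = delta_mx 0 0).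

Local Notation embed := (embed frac kap).

Definition coords : 'I_n.+2 -> L := ocons (embed F) (yvar kap).

Lemma coords_neq0 i : coords i != 0.
Proof.
apply: (ocons_all (Q := fun x => x != 0)) => [|j]; last exact: yvar_neq0.
by rewrite (inj_rmorph_eq0 (embed_inj frac_inj kap_inj)).
Qed.

Definition rowmon i := monz coords (row i M).

Lemma rowmon_neq0 i : rowmon i != 0.
Proof. exact/monz_neq0/coords_neq0. Qed.

Lemma rowmon_rel : \prod_j rowmon (lift ord0 j) ^+ e j = embed F * rowmon ord0 ^ omega.
Proof.
have : monz rowmon (relrow e omega) = embed F.
  by rewrite [LHS]monz_rows ?M_rel ?monz_delta; [exact: ocons0|exact: coords_neq0].
rewrite monz_relrow => <-.
by rewrite mulrAC -expfzDr ?rowmon_neq0 // addNr expr0z mul1r.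
Qed.

Variable psi : {rmorphism {mpoly A[n.+1]} -> L}.
Hypothesis psiC : forall i a, G i a -> psi a%:MP = embed a * rowmon ord0 ^ i.
Hypothesis psiX : forall j, psi 'X_j = rowmon (lift ord0 j).

Lemma psi_gpol : psi (gpol F e) = 0.
Proof.
rewrite rmorphB rmorph_prod /= (psiC GF); apply/eqP; rewrite subr_eq0; apply/eqP.
by rewrite -rowmon_rel; apply: eq_bigr => j _; rewrite rmorphXn psiX.
Qed.

Lemma psi_reduced_eq0 p : reduced e p -> psi p = 0 -> p = 0.
Proof.
move=> rp p0.
have dec m : exists sf : seq int * (int -> A),
    [/\ uniq sf.1, (forall i, G i (sf.2 i)) & p@_m = \sum_(i <- sf.1) sf.2 i].
  by have [s [f h]] := grade_decomp gr p@_m; exists (s, f).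
pose sf m := proj1_sig (constructive_indefinite_description _ (dec m)).
have hsf m : [/\ uniq (sf m).1, (forall i, G i ((sf m).2 i)) &
    p@_m = \sum_(i <- (sf m).1) (sf m).2 i].
  by rewrite /sf; case: constructive_indefinite_description.
pose J : seq ('X_{1..n.+1} * int) := [seq (m, i) | m <- msupp p, i <- (sf m).1].
have uJ : uniq J.
  apply: allpairs_uniq_dep => [|m _|[m i] [m' i'] _ _ []] //; first by case: (hsf m).
  by move=> -> ->.
pose w (x : 'X_{1..n.+1} * int) : 'rV[int]_n.+2 := \row_i ocons x.2 (fun j => (x.1 j)%:Z) i.
pose u x := w x *m M.
pose v x : 'rV[int]_n.+1 := \row_j u x 0 (lift ord0 j).
pose k x := frac ((sf x.1).2 x.2) * frac F ^ u x 0 ord0.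
have term x : psi ((sf x.1).2 x.2 *: 'X_[x.1]) = kap (k x)%:MP * monz (yvar kap) (v x).
  have [_ hf _] := hsf x.1.
  rewrite -mul_mpolyC rmorphM (psiC (hf x.2)) /= mpolyXE_id rmorph_prod.
  have -> : \prod_i psi ('X_i ^+ x.1 i) = \prod_i rowmon (lift ord0 i) ^+ x.1 i.
    by apply: eq_bigr => i _; rewrite rmorphXn psiX.
  have -> : embed ((sf x.1).2 x.2) * rowmon ord0 ^ x.2 * \prod_i rowmon (lift ord0 i) ^+ x.1 i
      = embed ((sf x.1).2 x.2) * monz coords (u x).
    rewrite -mulrA; congr (_ * _); rewrite /u -monz_rows; last exact: coords_neq0.
    rewrite monz_recl mxE ocons0; congr (_ * _); apply: eq_bigr => i _.
    by rewrite mxE oconsS.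
  rewrite monz_recl /k mpolyCM rmorphM -mulrA; congr (_ * (_ * _)).
    rewrite {1}/coords ocons0.
    exact/esym/(fmorphXz (kap \o @mpolyC n.+1 K)%FUN).
  by apply: eq_bigr => i _; rewrite [v x _ _]mxE; congr (_ ^ _); exact: oconsS.
have inJ x : x \in J -> x.1 \in msupp p.
  by move=> /allpairsPdep [m [i [hm hi ->]]].
have vinj : {in J &, injective v}.
  move=> x y xJ yJ /rowP ev.
  pose z := (u x - u y) 0 ord0.
  have ew : w x - w y = z *: relrow e omega.
    have : (w x - w y) *m M = (z *: relrow e omega) *m M.
      rewrite mulmxBl -scalemxAl M_rel -/(u x) -/(u y); apply/rowP => i.
      rewrite !mxE eqxx /=; case: (unliftP ord0 i) => [j ->|->].
        by have := ev j; rewrite !mxE => ->; rewrite subrr eq_sym (negbTE (neq_lift _ _)) mulr0.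
      by rewrite eqxx mulr1 /z !mxE.
    by move/(congr1 (mulmx^~ (invmx M))); rewrite !mulmxK.
  have e0 : x.2 - y.2 = z * - omega.
    by have := congr1 (fun t : 'rV[int]_n.+2 => t 0 ord0) ew; rewrite !mxE !ocons0.
  have ej j : (x.1 j)%:Z - (y.1 j)%:Z = z * (e j)%:Z.
    by have := congr1 (fun t : 'rV[int]_n.+2 => t 0 (lift ord0 j)) ew; rewrite !mxE !oconsS.
  have le_of (a b : 'X_{1..n.+1}) (t : int) : (0 < t) ->
      (forall j, (a j)%:Z - (b j)%:Z = t * (e j)%:Z) -> a \notin msupp p.
    move=> t0 h; rewrite -mcoeff_eq0; apply/eqP/rp/mnm_lepP => j; rewrite mnmE.
    have := h j; have := e_gt0 j; nia.
  have z0 : z = 0.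
    case: (ltrgtP z 0) => // hz.
      have /negP[] := @le_of y.1 x.1 (- z) ltac:(lia) (fun j => ltac:(have := ej j; lia)).
      exact: inJ.
    by have /negP[] := @le_of x.1 y.1 z hz ej; apply: inJ.
  rewrite z0 mul0r in e0; move: e0 ej; rewrite z0; case: x y {xJ yJ ev z ew z0} => x i [y i'] /= e0 ej.
  congr pair; last by lia.
  by apply/mnmP => j; have := ej j; rewrite mul0r; lia.
have sum0 : \sum_(x <- J) kap (k x)%:MP * monz (yvar kap) (v x) = 0.
  rewrite -[RHS]p0 [in RHS](mpolyE p) rmorph_sum /= /J big_allpairs_dep /=; apply: eq_bigr => m _.
  have [_ _ pm] := hsf m; rewrite [in RHS]pm scaler_suml rmorph_sum; apply: eq_bigr => i _.
  by rewrite -term.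
have k0 := laurent_indep kap_inj uJ vinj sum0.
apply/mpolyP => m; rewrite mcoeff0; apply/eqP; rewrite mcoeff_eq0; apply/negP => mp.
have := mp; rewrite mcoeff_msupp => /eqP; apply; have [_ _ ->] := hsf m.
rewrite big_seq big1 // => i im.
have /k0 /eqP : (m, i) \in J by apply/allpairsPdep; exists m, i.
rewrite /k /= mulf_eq0 (negbTE (expfz_neq0 _ _)) ?(inj_rmorph_eq0 frac_inj) // orbF.
by move/eqP.
Qed.

Lemma psi_kernel p : psi p = 0 <-> pdvd (gpol F e) p.
Proof.
split=> [p0|[c ->]]; last by rewrite rmorphM psi_gpol mulr0.
have [q [rq [d ed] _]] := reduce F e_gt0 ord0 0 p; rewrite expr0 mulr1 in ed.
have q0 : psi q = 0.
  have : psi (p - q) = 0 by rewrite ed rmorphM psi_gpol mulr0.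
  by rewrite rmorphB p0 sub0r => /eqP; rewrite oppr_eq0 => /eqP.
by exists d; rewrite -ed (psi_reduced_eq0 rq q0) subr0.
Qed.

End Embedding.

Lemma monzN (L : fieldType) N (x : 'I_N -> L) v : (forall i, x i != 0) ->
  monz x (- v) = (monz x v)^-1.
Proof.
move=> x0; apply: (mulIf (monz_neq0 v x0)).
rewrite -monzD // addNr mulVf ?monz_neq0 //.
by rewrite /monz big1 // => i _; rewrite mxE expr0z.
Qed.

(** * Factoriality of the quotient *)

(* The graph of the extension of [h r |-> lam r] to the fractions on which it is defined. *)
Section PartialMorphism.
Variables (R : idomainType) (L E : fieldType).
Variables (h : {rmorphism R -> L}) (lam : {rmorphism R -> E}).
Hypothesis h_inj : injective h.

Definition phom (l : L) (x : E) :=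
  exists r t, [/\ lam t != 0, l * h t = h r & x * lam t = lam r].

Lemma phom_img r : phom (h r) (lam r).
Proof. by exists r, 1; rewrite !rmorph1 !mulr1 oner_neq0. Qed.

Lemma phom1 : phom 1 1.
Proof. by rewrite -(rmorph1 h) -(rmorph1 lam); apply: phom_img. Qed.

Lemma phomM l l' x x' : phom l x -> phom l' x' -> phom (l * l') (x * x').
Proof.
move=> [r [t [t0 e1 e2]]] [r' [t' [t0' e1' e2']]]; exists (r * r'), (t * t').
by rewrite !rmorphM mulf_neq0 // -e1 -e2 -e1' -e2'; split=> //; ring.
Qed.

Lemma phomD l l' x x' : phom l x -> phom l' x' -> phom (l + l') (x + x').
Proof.
move=> [r [t [t0 e1 e2]]] [r' [t' [t0' e1' e2']]]; exists (r * t' + r' * t), (t * t').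
by rewrite !rmorphD !rmorphM mulf_neq0 // -e1 -e2 -e1' -e2'; split=> //; ring.
Qed.

Lemma phomV l x : x != 0 -> phom l x -> phom l^-1 x^-1.
Proof.
move=> x0 [r [t [t0 e1 e2]]]; have r0 : lam r != 0 by rewrite -e2 mulf_neq0.
have r0' : r != 0 by apply: contraNneq r0 => ->; rewrite rmorph0.
have l0 : l != 0.
  by apply: contraNneq r0' => l0; rewrite -(inj_rmorph_eq0 h_inj) -e1 l0 mul0r.
by exists t, r; rewrite -e1 -e2 !mulKf // mulf_neq0.
Qed.

Lemma phom0 x : phom 0 x -> x = 0.
Proof.
move=> [r [t [t0 /esym]]]; rewrite mul0r => /eqP.
rewrite inj_rmorph_eq0 // => /eqP -> /eqP.
by rewrite rmorph0 mulf_eq0 (negbTE t0) orbF => /eqP.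
Qed.

Lemma phomXz l x (z : int) : x != 0 -> phom l x -> phom (l ^ z) (x ^ z).
Proof.
move=> x0 hx; have Qn l' x' n : phom l' x' -> phom (l' ^+ n) (x' ^+ n).
  by move=> hx'; elim: n => [|n IH]; rewrite ?expr0 ?exprS; [exact: phom1|exact: phomM].
case: z => n; first by rewrite -!exprnP; apply: Qn.
by rewrite NegzE -!exprnN -!exprVn; apply/Qn/phomV.
Qed.

Lemma phom_monz N (x : 'I_N -> L) (y : 'I_N -> E) v : (forall i, y i != 0) ->
  (forall i, phom (x i) (y i)) -> phom (monz x v) (monz y v).
Proof.
move=> y0 hxy; apply: (big_ind2 phom) => [|*|i _]; [exact: phom1|exact: phomM|exact: phomXz].
Qed.

End PartialMorphism.

Lemma dvd_pow_count (R : idomainType) (u : R) (l : seq R) :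
  pdvd (u ^+ count_mem u l) (\prod_(y <- l) y).
Proof.
elim: l => [|y l [c ec]]; first by exists 1; rewrite big_nil expr0 mulr1.
rewrite big_cons ec /=; have [->|_] := eqVneq y u.
  by exists c; rewrite exprS; ring.
by exists (y * c); rewrite add0n mulrA.
Qed.

Lemma bounded_of_powers (R : idomainType) (x : R) (U : seq R) (S : R -> Prop) :
  (forall y, S y -> y \in U) ->
  (forall u, u \in U -> exists N, forall k, pdvd (u ^+ k) x -> (k <= N)%N) ->
  exists N : nat, forall s : seq R,
    (forall y, y \in s -> S y) -> pdvd (\prod_(y <- s) y) x -> (size s <= N)%N.
Proof.
move=> SU bd.
have [N hN] : exists N : nat, forall s : seq R, pdvd (\prod_(y <- s) y) x ->
    (\sum_(u <- U) count_mem u s <= N)%N.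
  elim: U bd {SU} => [|u U IH] bd; first by exists 0 => s _; rewrite big_nil.
  have [N1 h1] := bd u (mem_head _ _).
  have [|N2 h2] := IH; first by move=> v vU; apply: bd; rewrite inE vU orbT.
  exists (N1 + N2)%N => s ds; rewrite big_cons leq_add ?h2 // h1 //.
  exact: pdvd_trans (dvd_pow_count u s) ds.
exists N => s hs ds; apply: leq_trans (hN s ds).
elim: s hs {ds} => [|y s IH] hs; first by [].
rewrite /= big_split /= -add1n leq_add //; last first.
  by apply: IH => z zs; apply: hs; rewrite inE zs orbT.
by rewrite (perm_big _ (perm_to_rem (SU y (hs y (mem_head _ _))))) big_cons /= eqxx.
Qed.

Lemma factorial_of_poly (R : idomainType) : factorial_ring {poly R} -> factorial_ring R.
Proof.
move=> fP x x0; have [|s [hs e]] := fP x%:P; first by rewrite polyC_eq0.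
have s1 y : y \in s -> y = (y`_0)%:P.
  move=> ys; apply: size1_polyC; have := e; rewrite (perm_big _ (perm_to_rem ys)) big_cons /=.
  set q := \prod_(_ <- _) _ => e1; have : y * q != 0 by rewrite -e1 polyC_eq0.
  rewrite mulf_eq0 negb_or => /andP [y0 q0].
  have := size_mul y0 q0; rewrite -e1 size_polyC x0 /=.
  by rewrite -size_poly_gt0 in q0; case: (size y) (size q) q0 => [|[|a]] [|[|b]] //=; rewrite ?addnS.
exists [seq y`_0 | y : {poly R} <- s]; split; last first.
  rewrite big_map; apply: polyC_inj; rewrite e rmorph_prod /=.
  by rewrite !big_seq; apply: eq_bigr => y ys; apply: s1.
move=> _ /mapP [y ys ->]; have [y0 hy] := hs y ys.
have ey := s1 y ys; split; first by apply: contraNneq y0 => h; rewrite ey h.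
move=> a b [c ec].
have cst d : pdvd y d%:P -> pdvd y`_0 d.
  by move=> [q /(congr1 (coefp 0))]; rewrite /= coefC eqxx [in q * _]ey coefMC => ->; exists q`_0.
have /hy : pdvd y (a%:P * b%:P) by exists c%:P; rewrite -polyCM ec polyCM -ey.
by case=> /cst; [left|right].
Qed.

Lemma wprime_polyX (R : idomainType) : wprime ('X : {poly R}).
Proof.
have dvdX (p : {poly R}) : pdvd 'X p <-> p.[0] = 0.
  split=> [[c ->]|p0]; first by rewrite hornerMX mulr0.
  have /factor_theorem [q eq] : root p 0 by apply/eqP.
  by exists q; rewrite eq subr0.
split=> [|a b]; first by rewrite polyX_eq0.
rewrite !dvdX hornerM => /eqP; rewrite mulf_eq0.
by case/orP => /eqP; [left|right].
Qed.

Section QuotientUFD.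
Variables (A : idomainType) (G : int -> A -> Prop) (omega : int) (F : A).
Variables (n : nat) (e : 'I_n.+1 -> nat).
Hypotheses (gr : Zgrading G) (GF : G omega F) (F_neq0 : F != 0).
Hypothesis e_gt0 : forall i, (1 <= e i)%N.
Hypotheses (fA : factorial_ring A) (wF : wprime F) (F_nonunit : F \isn't a GRing.unit).
Variables (B : idomainType) (phi : {rmorphism {mpoly A[n.+1]} -> B}).
Hypothesis phi_surj : forall b, exists p, phi p = b.
Hypothesis phi_ker : forall p, phi p = 0 <-> pdvd (gpol F e) p.

Variables (K L Q : fieldType) (frac : {rmorphism A -> K}).
Variables (kap : {rmorphism {mpoly K[n.+1]} -> L}) (inc : {rmorphism {poly B} -> Q}).
Hypotheses (frac_inj : injective frac) (kap_inj : injective kap) (inc_inj : injective inc).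
Variable M : 'M[int]_n.+2.
Hypotheses (M_unit : M \in unitmx) (M_rel : relrow e omega *m M = delta_mx 0 0).

Local Notation embed := (embed frac kap).
Local Notation rowmon := (rowmon F frac kap M).
Local Notation coords := (coords F frac kap).

Variable psi : {rmorphism {mpoly A[n.+1]} -> L}.
Hypothesis psiC : forall i a, G i a -> psi a%:MP = embed a * rowmon ord0 ^ i.
Hypothesis psiX : forall j, psi 'X_j = rowmon (lift ord0 j).

Variable psiB : {rmorphism B -> L}.
Hypothesis psiB_phi : forall p, psiB (phi p) = psi p.

Let z j := phi 'X_j.
Let psi_ker := psi_kernel gr GF F_neq0 e_gt0 frac_inj kap_inj M_unit M_rel psiC psiX.

Lemma psiB_inj : injective psiB.
Proof.
move=> x y exy; apply/eqP; rewrite -subr_eq0; apply/eqP.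
have [p ep] := phi_surj (x - y); rewrite -ep; apply/phi_ker/psi_ker.
by rewrite -psiB_phi ep rmorphB exy subrr.
Qed.

Lemma phi_F : phi F%:MP = \prod_j z j ^+ e j.
Proof.
have /eqP : phi (gpol F e) = 0 by apply/phi_ker/pdvd_refl.
rewrite rmorphB rmorph_prod subr_eq0 => /eqP <-.
by apply: eq_bigr => j _; rewrite rmorphXn.
Qed.

Section Specialize.
Variable j : 'I_n.+1.

Definition kill_var : {rmorphism {mpoly A[n.+1]} -> {mpoly A[n.+1]}} :=
  mmap (@mpolyC n.+1 A) (fun k => if k == j then 0 else 'X_k).

Lemma kill_varC c : kill_var c%:MP = c%:MP.
Proof. exact: mmapC. Qed.

Lemma kill_varX k : kill_var 'X_k = if k == j then 0 else 'X_k.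
Proof. by rewrite /kill_var /= mmapX mmap1U. Qed.

Lemma kill_var_gpol : kill_var (gpol F e) = - F%:MP.
Proof.
rewrite rmorphB kill_varC rmorph_prod (bigD1 j) //= rmorphXn kill_varX eqxx.
by rewrite expr0n eqn0Ngt e_gt0 mul0r sub0r.
Qed.

Lemma kill_var_rem p : pdvd 'X_j (p - kill_var p).
Proof.
elim/mpoly_gen_ind: p => [c|k|p q [u eu] [v ev]|p q [u eu] [v ev]].
- by exists 0; rewrite kill_varC subrr mul0r.
- rewrite kill_varX; case: eqP => [->|_]; first by exists 1; rewrite subr0 mul1r.
  by exists 0; rewrite subrr mul0r.
- exists (u + v); rewrite mulrDl -eu -ev rmorphD; ring.
- exists (u * q + kill_var p * v); rewrite mulrDl -mulrA -[kill_var p * v * _]mulrA -ev.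
  by rewrite [q * _]mulrC mulrA -eu rmorphM; ring.
Qed.

Lemma z_dvd p : pdvd (z j) (phi p) <-> pdvd F%:MP (kill_var p).
Proof.
split=> [[b eb]|[d ed]].
  have [r er] := phi_surj b.
  have [d ed] : pdvd (gpol F e) (p - r * 'X_j).
    by apply/phi_ker; rewrite rmorphB rmorphM er eb subrr.
  exists (- kill_var d); rewrite -[p](subrK (r * 'X_j)) ed rmorphD !rmorphM.
  by rewrite kill_var_gpol kill_varX eqxx mulr0 addr0 mulrN mulNr.
have [r er] := kill_var_rem p; rewrite -[p](subrK (kill_var p)) er ed rmorphD !rmorphM.
have [w ew] : pdvd (z j) (phi F%:MP).
  rewrite phi_F (bigD1 j) //= -[e j]prednK // exprS -mulrA.
  by apply/pdvd_mulr/pdvd_refl.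
exists (phi r + phi d * w); rewrite ew; ring.
Qed.

Lemma z_wprime : wprime (z j).
Proof.
have [F0 hF] := wprime_mpolyC n.+1 wF; split.
  apply/eqP => z0; have := psiB_phi 'X_j; rewrite -/(z j) z0 rmorph0 psiX => /esym/eqP.
  exact/negP/(rowmon_neq0 F_neq0 frac_inj kap_inj).
move=> a b; have [p <-] := phi_surj a; have [q <-] := phi_surj b.
by rewrite -rmorphM !z_dvd rmorphM; apply: hF.
Qed.

Lemma z_nonunit : ~ pdvd (z j) 1.
Proof.
rewrite -(rmorph1 phi) z_dvd rmorph1 => -[c /(congr1 (mcoeff 0%MM))].
rewrite rmorphM rmorph1 /= mpolyCK => e1; case/negP: F_nonunit.
by apply/unitrP; exists c@_0%MM; rewrite [F * _]mulrC -e1.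
Qed.

Lemma z_bounded b : b != 0 -> exists N, forall k, pdvd (z j ^+ k) b -> (k <= N)%N.
Proof.
move=> b0; apply: NNPP => no.
have all_dvd k : pdvd (z j ^+ k) b.
  apply: NNPP => nd; apply: no; exists k => k' dk'; rewrite leqNgt; apply/negP => lk.
  apply: nd; apply: pdvd_trans dk'; exists (z j ^+ (k' - k)).
  by rewrite -exprD subnK // ltnW.
have [p ep] := phi_surj b; have [q [rq dq _]] := reduce F e_gt0 ord0 0 p.
have eq : phi q = b.
  by move/phi_ker: dq; rewrite expr0 mulr1 rmorphB ep => /eqP; rewrite subr_eq0 => /eqP.
have [m mq] : exists m, q@_m != 0.
  apply: NNPP => nm; case/eqP: b0; rewrite -eq; have -> : q = 0; last exact: rmorph0.
  by apply/mpolyP => m; rewrite mcoeff0; apply/eqP; apply: contraT => mq; case: nm; exists m.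
have Fdvd t : pdvd (F ^+ t) q@_m.
  have [c ec] := all_dvd (t * e j + m j)%N; have [r er] := phi_surj c.
  have [q' [rq' dq' hq']] := reduce F e_gt0 j (t * e j + m j) r.
  have e' : phi q' = b.
    move/phi_ker: dq'; rewrite rmorphB rmorphM rmorphXn er -/(z j) -ec => /eqP.
    by rewrite subr_eq0 => /eqP.
  have -> : q = q'; last exact: hq'.
  apply/eqP; rewrite -subr_eq0; apply/eqP.
  apply: (psi_reduced_eq0 gr F_neq0 e_gt0 frac_inj kap_inj M_unit M_rel psiC psiX).
    exact: reducedB.
  by apply/psi_ker/phi_ker; rewrite rmorphB eq e' subrr.
have [u [s [uu hs es]]] := factorial_nonunit fA mq.
have := @wprime_count A (nseq (size s).+1 F) s u uu _ hs.
rewrite size_nseq ltnn => H; suff : false by []; apply: H.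
  by move=> y; rewrite mem_nseq => /andP [_ /eqP ->].
by rewrite -es big_nseq -/(iterop _ _ _ _) -Monoid.iteropE; apply: Fdvd.
Qed.

End Specialize.

Lemma ext_comm : commr_rmorph psiB (rowmon ord0).
Proof. by move=> x; apply: mulrC. Qed.

Definition ext : {rmorphism {poly B} -> L} := horner_morph ext_comm.

Lemma extC b : ext b%:P = psiB b. Proof. exact: horner_morphC. Qed.
Lemma extX : ext 'X = rowmon ord0. Proof. exact: horner_morphX. Qed.

Lemma polyB_ind (W : {poly B} -> Prop) :
  (forall i a, G i a -> W (phi a%:MP)%:P) -> (forall j, W (z j)%:P) -> W 'X ->
  (forall p q, W p -> W q -> W (p + q)) -> (forall p q, W p -> W q -> W (p * q)) ->
  forall p, W p.
Proof.
move=> WA Wz WX WD WM; have WC b : W b%:P.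
  have [p <-] := phi_surj b; elim/(grade_gen_ind gr): p => // p q Wp Wq.
    by rewrite rmorphD polyCD; apply: WD.
  by rewrite rmorphM polyCM; apply: WM.
by elim/poly_ind => [|p c Wp]; [exact: WC|apply: WD => //; apply: WM].
Qed.

Local Notation rmap := (mpoly_embed frac kap).
Let rmap_inj := mpoly_embed_inj frac_inj kap_inj.

Let W : 'I_n.+2 -> Q := ocons (inc 'X) (fun j => inc (z j)%:P).

Let W_neq0 i : W i != 0.
Proof.
apply: (ocons_all (Q := fun x => x != 0)) => [|j]; rewrite inj_rmorph_eq0 //.
  by rewrite polyX_eq0.
by rewrite polyC_eq0; have [] := z_wprime j.
Qed.

Let X' i := monz W (row i (invmx M)).

Let X'_neq0 i : X' i != 0. Proof. exact: monz_neq0. Qed.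

Lemma row0_invmx : row 0 (invmx M) = relrow e omega.
Proof. by rewrite rowE -M_rel mulmxK. Qed.

Lemma ext_inj : injective ext.
Proof.
pose incA : {rmorphism A -> Q} := (inc \o (polyC \o (phi \o @mpolyC n.+1 A)))%FUN.
have [|||lam [lamC lamX]] := @twist_mpoly A G gr Q incA (fun i => W ord0 ^ (- i)) _ _ _
    n.+1 (fun k => X' (lift ord0 k)).
- by rewrite oppr0 expr0z.
- by move=> i j _ _ _ _ _ _; rewrite opprD expfzDr.
- exact: (grade_one gr GF F_neq0).
pose H := phom rmap lam.
have Hcoords i : H (coords i) (X' i).
  case: (unliftP ord0 i) => [k ->|->]; rewrite /coords ?oconsS ?ocons0.
    by rewrite -(mpoly_embedX frac) -lamX; apply: phom_img.
  have -> : X' ord0 = lam F%:MP.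
    rewrite (lamC _ _ GF) /X' row0_invmx monz_relrow mulrC; congr (_ * _).
    rewrite /incA /= phi_F rmorph_prod /= rmorph_prod; apply: eq_bigr => j _.
    by rewrite /W oconsS !rmorphXn.
  by rewrite -mpoly_embedC; apply: phom_img.
have Hrow i : H (rowmon i) (W i).
  have -> : W i = monz X' (row i M).
    by rewrite [RHS]monz_rows // rowE -mulmxA mulmxV // mulmx1 monz_delta.
  exact: phom_monz rmap_inj _ _ _ _ X'_neq0 Hcoords.
have Hall p : H (ext p) (inc p).
  elim/polyB_ind: p => [i a ha|j||p q hp hq|p q hp hq].
  - rewrite extC psiB_phi (psiC ha); have -> : inc (phi a%:MP)%:P = lam a%:MP * W ord0 ^ i.
      by rewrite (lamC _ _ ha) -mulrA -expfzDr // addNr expr0z mulr1.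
    apply: phomM; first by rewrite -mpoly_embedC; apply: phom_img.
    exact: phomXz rmap_inj _ _ _ (W_neq0 _) (Hrow _).
  - rewrite extC psiB_phi psiX; have := Hrow (lift ord0 j); by rewrite {1}/W oconsS.
  - by rewrite extX; have := Hrow ord0; rewrite {1}/W ocons0.
  - by rewrite !rmorphD; apply: phomD.
  - by rewrite !rmorphM; apply: phomM.
move=> p q epq; apply/eqP; rewrite -subr_eq0; apply/eqP/inc_inj; rewrite rmorph0.
apply: (phom0 rmap_inj); rewrite -(subrr (ext q)) -{1}epq -rmorphB; exact: Hall.
Qed.

Definition loc_vars (p : {poly B}) := p = 'X \/ exists j, p = (z j)%:P.
Definition loc_coords (r : {mpoly A[n.+1]}) := r = F%:MP \/ exists k, r = 'X_k.

Lemma loc_vars_neq0 p : loc_vars p -> p != 0.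
Proof.
case=> [->|[j ->]]; first by rewrite polyX_eq0.
by rewrite polyC_eq0; have [] := z_wprime j.
Qed.

Lemma loc_coords_neq0 r : loc_coords r -> r != 0.
Proof.
case=> [->|[k ->]]; first by rewrite mpolyC_eq0.
by rewrite -(inj_rmorph_eq0 rmap_inj) mpoly_embedX; apply: yvar_neq0.
Qed.

Lemma ext_same_loc l : loc ext loc_vars l <-> loc rmap loc_coords l.
Proof.
have cn0 := coords_neq0 F_neq0 frac_inj kap_inj.
have rn0 := rowmon_neq0 F_neq0 frac_inj kap_inj M.
have locP_img := loc_img ext loc_vars; have locR_img := loc_img rmap loc_coords.
have prodV (R : idomainType) (f : {rmorphism R -> L}) (D : L -> Prop) (S : R -> Prop) :
    D 1 -> (forall a b, D a -> D b -> D (a * b)) -> (forall s, S s -> D (f s)^-1) ->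
    forall s, prods S s -> D (f s)^-1.
  move=> D1 DM DS _ [t [ht ->]]; elim: t ht => [|y t IH] ht.
    by rewrite big_nil rmorph1 invr1.
  rewrite big_cons rmorphM invfM; apply: DM; first by apply: DS; apply: ht; rewrite inE eqxx.
  by apply: IH => x xt; apply: ht; rewrite inE xt orbT.
have P1 : loc ext loc_vars 1 by rewrite -(rmorph1 ext); apply: locP_img.
have R1 : loc rmap loc_coords 1 by rewrite -(rmorph1 rmap); apply: locR_img.
have PM := @locM _ _ ext loc_vars; have RM := @locM _ _ rmap loc_coords.
have rowP i : loc ext loc_vars (rowmon i) /\ loc ext loc_vars (rowmon i)^-1.
  have [x [vx <-]] : exists x, loc_vars x /\ ext x = rowmon i.
    case: (unliftP ord0 i) => [j ->|->].
      by exists (z j)%:P; rewrite extC psiB_phi psiX; split=> //; right; exists j.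
    by exists 'X; rewrite extX; split=> //; left.
  by split; [exact: locP_img|exact: loc_invimg ext_inj _ loc_vars_neq0 _ (prods_mem vx)].
have coordsR i : loc rmap loc_coords (coords i) /\ loc rmap loc_coords (coords i)^-1.
  have [x [vx <-]] : exists x, loc_coords x /\ rmap x = coords i.
    case: (unliftP ord0 i) => [j ->|->].
      by exists 'X_j; rewrite mpoly_embedX [RHS]oconsS; split=> //; right; exists j.
    by exists F%:MP; rewrite mpoly_embedC [RHS]ocons0; split=> //; left.
  by split; [exact: locR_img|exact: loc_invimg rmap_inj _ loc_coords_neq0 _ (prods_mem vx)].
have coordsE i : coords i = monz rowmon (row i (invmx M)).
  by rewrite [RHS]monz_rows // rowE -mulmxA mulVmx // mulmx1 monz_delta.
have coordsP v : loc ext loc_vars (monz coords v).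
  have -> : monz coords v = monz rowmon (v *m invmx M).
    by rewrite [RHS]monz_rows // -mulmxA mulVmx // mulmx1.
  by apply: monz_closed => // i; have [] := rowP i.
have rowR v : loc rmap loc_coords (monz rowmon v).
  rewrite [monz _ _]monz_rows //.
  by apply: monz_closed => // i; have [] := coordsR i.
have coordP i : loc ext loc_vars (coords i) /\ loc ext loc_vars (coords i)^-1.
  by rewrite -(monz_delta coords i) -monzN.
have rowRi i : loc rmap loc_coords (rowmon i) /\ loc rmap loc_coords (rowmon i)^-1.
  by rewrite -(monz_delta rowmon i) -monzN.
have extR p : loc rmap loc_coords (ext p).
  elim/polyB_ind: p => [i a ha|j||p q hp hq|p q hp hq].
  - rewrite extC psiB_phi (psiC ha) -mpoly_embedC; apply: (RM) => //.
    have [r1 r2] := rowRi ord0; exact: exprz_closed R1 RM r1 r2.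
  - by rewrite extC psiB_phi psiX; have [] := rowRi (lift ord0 j).
  - by rewrite extX; have [] := rowRi ord0.
  - by rewrite rmorphD; apply: locD.
  - by rewrite rmorphM; apply: (RM).
have rmapP r : loc ext loc_vars (rmap r).
  elim/(grade_gen_ind gr): r => [i a ha|k|p q hp hq|p q hp hq].
  - rewrite mpoly_embedC; have -> : embed a = ext (phi a%:MP)%:P * rowmon ord0 ^ (- i).
      by rewrite extC psiB_phi (psiC ha) -mulrA -expfzDr // subrr expr0z mulr1.
    apply: (PM) => //; have [r1 r2] := rowP ord0; exact: exprz_closed P1 PM r1 r2.
  - by rewrite mpoly_embedX; have [] := coordP (lift ord0 k); rewrite [coords _]oconsS.
  - by rewrite rmorphD; apply: locD.
  - by rewrite rmorphM; apply: (PM).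
split=> [[x [s [hs el]]]|[x [s [hs el]]]].
  have s0 := prods_img_neq0 ext_inj loc_vars_neq0 hs.
  have -> : l = ext x * (ext s)^-1 by rewrite -el mulfK.
  apply: (RM) => //; apply: (prodV _ ext _ loc_vars) => // y [->|[j ->]].
    by rewrite extX; have [] := rowRi ord0.
  by rewrite extC psiB_phi psiX; have [] := rowRi (lift ord0 j).
have s0 := prods_img_neq0 rmap_inj loc_coords_neq0 hs.
have -> : l = rmap x * (rmap s)^-1 by rewrite -el mulfK.
apply: (PM) => //; apply: (prodV _ rmap _ loc_coords) => // y [->|[j ->]].
  by rewrite mpoly_embedC; have [] := coordP ord0; rewrite [coords _]ocons0.
by rewrite mpoly_embedX; have [] := coordP (lift ord0 j); rewrite [coords _]oconsS.
Qed.

Theorem quotient_factorial : factorial_ring B.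
Proof.
apply: factorial_of_poly.
refine (nagata ext_inj rmap_inj _ _ _ loc_coords_neq0 ext_same_loc (mpoly_factorial fA)).
- move=> _ [->|[j ->]]; [exact: wprime_polyX|exact/wprime_polyC/z_wprime].
- move=> s [->|[j ->]] [c ec].
    by have := congr1 (horner^~ 0) ec; rewrite hornerMX mulr0 hornerC => /eqP; rewrite oner_eq0.
  apply: (@z_nonunit j); exists c`_0.
  by have := congr1 (coefp 0) ec; rewrite /= coefMC coef1.
move=> x x0; apply: (@bounded_of_powers _ x ('X :: [seq (z j)%:P | j <- enum 'I_n.+1])).
  move=> y [->|[j ->]]; rewrite inE ?eqxx //.
  by apply/orP; right; apply/mapP; exists j; rewrite // mem_enum.
move=> u; rewrite inE => /orP [/eqP ->|/mapP [j _ ->]].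
  exists (size x) => k [c ec]; have c0 : c != 0.
    by apply: contraNneq x0 => c0; rewrite ec c0 mul0r.
  by rewrite ec size_mulXn // leq_addr.
have [|N hN] := @z_bounded j (lead_coef x); first by rewrite lead_coef_eq0.
exists N => k [c ec]; apply: hN; exists (lead_coef c).
by rewrite ec lead_coefM -rmorphXn lead_coefC.
Qed.

End QuotientUFD.

(** * The fraction field of the quotient *)

Section FractionField.
Variables (A : idomainType) (G : int -> A -> Prop) (omega : int) (F : A).
Variables (n : nat) (e : 'I_n.+1 -> nat).
Hypotheses (gr : Zgrading G) (GF : G omega F) (F_neq0 : F != 0).
Variables (B : idomainType) (phi : {rmorphism {mpoly A[n.+1]} -> B}).
Hypothesis phi_surj : forall b, exists p, phi p = b.
Hypothesis phi_ker : forall p, phi p = 0 <-> pdvd (gpol F e) p.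

Variables (K L E : fieldType) (frac : {rmorphism A -> K}).
Variables (kap : {rmorphism {mpoly K[n]} -> L}) (incB : {rmorphism B -> E}).
Hypotheses (frac_inj : injective frac) (kap_inj : injective kap) (incB_inj : injective incB).
Hypothesis frac_rep : forall k, exists a b, b != 0 /\ k = frac a / frac b.
Hypothesis kap_rep : forall l, exists p q, q != 0 /\ l = kap p / kap q.
Hypothesis incB_rep : forall x, exists a b, b != 0 /\ x = incB a / incB b.

Variables (delta m p1 p2 : int) (t1 t2 : A).
Hypotheses (G_t1 : G p1 t1) (G_t2 : G p2 t2) (t1_neq0 : t1 != 0) (t2_neq0 : t2 != 0).
Hypotheses (deg_t : p1 = delta + p2) (m_delta : omega = m * delta).
Hypothesis deg_dvd : forall i a, G i a -> a != 0 -> (delta %| i)%Z.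

Variable M : 'M[int]_n.+2.
Hypotheses (M_unit : M \in unitmx) (M_rel : relrow e m *m M = delta_mx 0 0).
Hypothesis M_row0 : delta = 0 -> row ord0 M = delta_mx 0 (lift ord0 ord0).

Local Notation embed := (embed frac kap).
Local Notation rmap := (mpoly_embed frac kap).
Let one := lift ord0 ord0 : 'I_n.+2.

Let embed_neq0 a : a != 0 -> embed a != 0.
Proof. by move=> a0; rewrite (inj_rmorph_eq0 (embed_inj frac_inj kap_inj)). Qed.

Let t := embed t1 / embed t2.
Let t_neq0 : t != 0. Proof. by rewrite mulf_neq0 ?invr_eq0 ?embed_neq0. Qed.

Let X : 'I_n.+2 -> L := ocons (embed F * t ^ (- m)) (ocons t (yvar kap)).

Let X_neq0 i : X i != 0.
Proof.
apply: (ocons_all (Q := fun x => x != 0)) => [|j]; first by rewrite mulf_neq0 ?expfz_neq0 ?embed_neq0.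
by apply: (ocons_all (Q := fun x => x != 0)) => [|k] //; apply: yvar_neq0.
Qed.

Let rowm i := monz X (row i M).
Let rowm_neq0 i : rowm i != 0. Proof. exact: monz_neq0. Qed.

(* Elements of [A_i] are multiplied by [c ^ (i / delta)]; this sends the
   homogeneous fraction [t] of degree [delta] to [rowm ord0]. *)
Let c := t^-1 * rowm ord0.
Let c_neq0 : c != 0. Proof. by rewrite mulf_neq0 ?invr_eq0. Qed.

Let c1 : delta = 0 -> c = 1.
Proof.
move=> d0; rewrite /c /rowm M_row0 // monz_delta /X oconsS ocons0.
exact: mulVf.
Qed.

Let cdelta : c ^ (delta %/ delta)%Z = c.
Proof.
have [d0|d0] := eqVneq delta 0; first by rewrite c1 // exp1rz.
by rewrite divzz d0 expr1z.
Qed.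

Let comega : c ^ (omega %/ delta)%Z = c ^ m.
Proof.
have [d0|d0] := eqVneq delta 0; first by rewrite c1 // !exp1rz.
by rewrite m_delta mulzK.
Qed.

Let divD (i j : int) a b : G i a -> G j b -> a != 0 -> b != 0 ->
  ((i + j) %/ delta)%Z = (i %/ delta)%Z + (j %/ delta)%Z.
Proof. by move=> ha _ a0 _; rewrite divzDl // (deg_dvd ha a0). Qed.

Let div_t : (p1 %/ delta)%Z = (delta %/ delta)%Z + (p2 %/ delta)%Z.
Proof. by rewrite deg_t divzDl // dvdzz. Qed.

Let has_one := grade_one gr GF F_neq0.

Let rowm_rel : \prod_j rowm (lift ord0 j) ^+ e j = embed F * c ^ m.
Proof.
have : monz rowm (relrow e m) = embed F * t ^ (- m).
  by rewrite [LHS]monz_rows // M_rel monz_delta /X ocons0.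
rewrite monz_relrow => h; rewrite /c expfzMl exprz_inv mulrA -h.
by rewrite mulrAC -expfzDr // addNr expr0z mul1r.
Qed.

Theorem fraction_field_iso : exists f : {rmorphism E -> L}, bijective f.
Proof.
have [|||psi [psiC psiX]] := @twist_mpoly A G gr L embed (fun i => c ^ (i %/ delta)%Z) _ _ _
    n.+1 (fun j => rowm (lift ord0 j)).
- by rewrite div0z expr0z.
- by move=> i j a b ha hb a0 b0; rewrite (divD ha hb) // expfzDr.
- exact: has_one.
have psi_g : psi (gpol F e) = 0.
  rewrite rmorphB rmorph_prod /= (psiC _ _ GF) comega -rowm_rel.
  by apply/eqP; rewrite subr_eq0; apply/eqP/eq_bigr => j _; rewrite rmorphXn psiX.
have [|psiB psiBE] := @rmorphism_factor _ _ _ phi psi phi_surj.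
  by move=> p /phi_ker [d ->]; rewrite rmorphM psi_g mulr0.
pose iE : {rmorphism A -> E} := (incB \o (phi \o @mpolyC n.+1 A))%FUN.
have iE_neq0 i a : G i a -> a != 0 -> iE a != 0.
  move=> ha a0; rewrite /iE /= inj_rmorph_eq0 //; apply/eqP => h.
  have := psiBE a%:MP; rewrite h rmorph0 (psiC _ _ ha) => /esym/eqP; apply/negP.
  by rewrite mulf_neq0 ?expfz_neq0 ?embed_neq0.
pose z j := incB (phi 'X_j).
have z_neq0 j : z j != 0.
  rewrite inj_rmorph_eq0 //; apply/eqP => h.
  by have := psiBE 'X_j; rewrite h rmorph0 psiX => /esym/eqP; apply/negP.
have phi_F : iE F = \prod_j z j ^+ e j.
  have /eqP : phi (gpol F e) = 0 by apply/phi_ker/pdvd_refl.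
  rewrite rmorphB rmorph_prod subr_eq0 => /eqP h; rewrite /iE /= -h rmorph_prod.
  by apply: eq_bigr => j _; rewrite !rmorphXn.
pose tE := iE t1 / iE t2.
have tE_neq0 : tE != 0 by rewrite mulf_neq0 ?invr_eq0 ?(iE_neq0 _ _ G_t1) ?(iE_neq0 _ _ G_t2).
pose W : 'I_n.+2 -> E := ocons tE z.
have W_neq0 i : W i != 0 by apply: (ocons_all (Q := fun x => x != 0)).
pose X' i := monz W (row i (invmx M)).
have X'_neq0 i : X' i != 0 by exact: monz_neq0.
pose c' := tE^-1 * X' one.
have c'_neq0 : c' != 0 by rewrite mulf_neq0 ?invr_eq0.
have c1' : delta = 0 -> c' = 1.
  move=> d0; rewrite /c' /X' rowE -(M_row0 d0) rowE mulmxK // monz_delta /W ocons0.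
  exact: mulVf.
have cdelta' : c' ^ (delta %/ delta)%Z = c'.
  have [d0|d0] := eqVneq delta 0; first by rewrite c1' // exp1rz.
  by rewrite divzz d0 expr1z.
have comega' : c' ^ (omega %/ delta)%Z = c' ^ m.
  have [d0|d0] := eqVneq delta 0; first by rewrite c1' // !exp1rz.
  by rewrite m_delta mulzK.
have [|||lam [lamC lamX]] := @twist_mpoly A G gr E iE (fun i => c' ^ (i %/ delta)%Z) _ _ _
    n (fun k => X' (lift ord0 (lift ord0 k))).
- by rewrite div0z expr0z.
- by move=> i j a b ha hb a0 b0; rewrite (divD ha hb) // expfzDr.
- exact: has_one.
have rmap_inj := mpoly_embed_inj frac_inj kap_inj.
pose H := phom rmap lam.
have HA a : H (embed a) (lam a%:MP) by rewrite -mpoly_embedC; apply: phom_img.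
have HM l l' x x' : H l x -> H l' x' -> H (l * l') (x * x') by apply: phomM.
have HV l x : x != 0 -> H l x -> H l^-1 x^-1 by apply: phomV.
have HXz l x (k : int) : x != 0 -> H l x -> H (l ^ k) (x ^ k) by apply: phomXz.
have lam_neq0 i a : G i a -> a != 0 -> lam a%:MP != 0.
  by move=> ha a0; rewrite (lamC _ _ ha) mulf_neq0 ?expfz_neq0 ?(iE_neq0 _ _ ha).
have Ht : H t (X' one).
  have -> : X' one = lam t1%:MP / lam t2%:MP.
    rewrite (lamC _ _ G_t1) (lamC _ _ G_t2) div_t expfzDr // cdelta' invfM.
    have cp0 : c' ^ (p2 %/ delta)%Z != 0 by rewrite expfz_neq0.
    rewrite mulrA [_ * (c' * _)]mulrA -[_ * _ / iE t2]mulrA [_ / iE t2]mulrC mulrA mulrK ?unitfE //.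
    by rewrite mulrAC -/tE /c' mulVKf.
  by apply: (HM) => //; apply: (HV) => //; apply: lam_neq0 G_t2 t2_neq0.
have HX i : H (X i) (X' i).
  case: (unliftP ord0 i) => [j ->|->]; rewrite /X ?oconsS ?ocons0.
    case: (unliftP ord0 j) => [k ->|->]; rewrite ?oconsS ?ocons0 //.
    by rewrite -(mpoly_embedX frac) -lamX; apply: phom_img.
  have -> : X' ord0 = lam F%:MP * X' one ^ (- m).
    rewrite (lamC _ _ GF) comega' {1}/X' rowE -M_rel mulmxK // monz_relrow {1}/W ocons0.
    rewrite [c' ^ _]expfzMl [tE^-1 ^ _]exprz_inv -[RHS]mulrA -[X in _ = _ * X]mulrA -expfzDr // subrr expr0z mulr1.
    rewrite mulrC phi_F; congr (_ * _).
    by apply: eq_bigr => j _; rewrite /W oconsS.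
  by apply: (HM) => //; apply: (HXz).
have Hrow i : H (rowm i) (W i).
  have -> : W i = monz X' (row i M).
    by rewrite [RHS]monz_rows // rowE -mulmxA mulmxV // mulmx1 monz_delta.
  exact: phom_monz rmap_inj _ _ _ _ X'_neq0 HX.
have Hc : H c c'^-1.
  rewrite /c' invfM invrK mulrC; apply: (HM); first exact: HV.
  by have := Hrow ord0; rewrite {1}/W ocons0.
have Hpsi p : H (psi p) (incB (phi p)).
  elim/(grade_gen_ind gr): p => [i a ha|j|p q hp hq|p q hp hq].
  - rewrite (psiC _ _ ha).
    have -> : incB (phi a%:MP) = lam a%:MP * c'^-1 ^ (i %/ delta)%Z.
      by rewrite (lamC _ _ ha) -mulrA -expfzMl mulfV // exp1rz mulr1.
    by apply: (HM) => //; apply: (HXz) => //; rewrite invr_eq0.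
  - by rewrite psiX; have := Hrow (lift ord0 j); rewrite {1}/W oconsS.
  - by rewrite !rmorphD; apply: phomD.
  - by rewrite !rmorphM; apply: phomM.
have psiB_inj : injective psiB.
  move=> x y exy; apply/eqP; rewrite -subr_eq0; apply/eqP/incB_inj; rewrite rmorph0.
  have [p ep] := phi_surj (x - y); rewrite -ep; apply: (phom0 rmap_inj (lam := lam)).
  by have := Hpsi p; rewrite -psiBE ep rmorphB exy subrr.
have [f fB] := rmorphism_extend incB_inj psiB_inj incB_rep.
pose im l := exists x, f x = l.
have im1 : im 1 by exists 1; rewrite rmorph1.
have imM l l' : im l -> im l' -> im (l * l').
  by move=> [x <-] [y <-]; exists (x * y); rewrite rmorphM.
have imD l l' : im l -> im l' -> im (l + l').
  by move=> [x <-] [y <-]; exists (x + y); rewrite rmorphD.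
have imV l : im l -> im l^-1 by move=> [x <-]; exists x^-1; rewrite fmorphV.
have imXz l k : im l -> im (l ^ k) by move=> [x <-]; exists (x ^ k); rewrite fmorphXz.
have im_psi p : im (psi p) by exists (incB (phi p)); rewrite fB psiBE.
have im_row i : im (rowm i).
  case: (unliftP ord0 i) => [j ->|->]; first by rewrite -psiX.
  have -> : rowm ord0 = psi t1%:MP / psi t2%:MP.
    rewrite (psiC _ _ G_t1) (psiC _ _ G_t2) div_t expfzDr // cdelta invfM.
    have cp0 : c ^ (p2 %/ delta)%Z != 0 by rewrite expfz_neq0.
    rewrite mulrA [_ * (c * _)]mulrA -[_ * _ / embed t2]mulrA [_ / embed t2]mulrC mulrA mulrK ?unitfE //.
    by rewrite mulrAC -/t /c mulVKf.
  by apply: (imM) => //; apply: (imV).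
have imX i : im (X i).
  have -> : X i = monz rowm (row i (invmx M)).
    by rewrite [RHS]monz_rows // rowE -mulmxA mulVmx // mulmx1 monz_delta.
  by apply: monz_closed => // j; apply: (imV).
have im_t : im t by have := imX one; rewrite /X oconsS ocons0.
have im_c : im c by apply: (imM) => //; apply: (imV).
have im_rmap r : im (rmap r).
  elim/(grade_gen_ind gr): r => [i a ha|k|p q hp hq|p q hp hq].
  - have -> : rmap a%:MP = psi a%:MP * c ^ (- (i %/ delta)%Z).
      by rewrite mpoly_embedC (psiC _ _ ha) -mulrA -expfzDr // subrr expr0z mulr1.
    by apply: (imM) => //; apply: (imXz).
  - by have := imX (lift ord0 (lift ord0 k)); rewrite /X !oconsS mpoly_embedX.
  - by rewrite rmorphD; apply: (imD).
  - by rewrite rmorphM; apply: (imM).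
have im_kap p : im (kap p).
  elim/mpoly_gen_ind: p => [k|k|p q hp hq|p q hp hq].
  - have [a [b [b0 ->]]] := frac_rep k.
    have -> : kap (frac a / frac b)%:MP = rmap a%:MP / rmap b%:MP.
      rewrite !mpoly_embedC; exact: (fmorph_div (kap \o @mpolyC n K)%FUN).
    by apply: (imM) => //; apply: (imV).
  - by have := im_rmap 'X_k; rewrite mpoly_embedX.
  - by rewrite rmorphD; apply: (imD).
  - by rewrite rmorphM; apply: (imM).
have surj l : im l.
  by have [p [q [_ ->]]] := kap_rep l; apply: (imM) => //; apply: (imV).
exists f; pose f' l := proj1_sig (constructive_indefinite_description _ (surj l)).
have f'K : cancel f' f by move=> l; rewrite /f'; case: constructive_indefinite_description.
by exists f' => // x; apply: (fmorph_inj f); rewrite f'K.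
Qed.

End FractionField.

Definition quotient_degree (A : idomainType) (G : int -> A -> Prop) (i : int) :=
  exists p q a b, [/\ G p a, G q b, a != 0, b != 0 & p = i + q].

Lemma degree_generator (A : idomainType) (G : int -> A -> Prop) (omega : int) (F : A) :
  Zgrading G -> G omega F -> F != 0 -> omega != 0 ->
  exists delta, [/\ delta != 0, quotient_degree G delta &
    forall i a, G i a -> a != 0 -> (delta %| i)%Z].
Proof.
move=> gr GF F0 w0; have GM := gradeM gr.
have degD i j : quotient_degree G i -> quotient_degree G j -> quotient_degree G (i + j).
  move=> [p [q [a [b [ha hb a0 b0 ei]]]]] [p' [q' [a' [b' [ha' hb' a0' b0' ej]]]]].
  exists (p + p'), (q + q'), (a * a'), (b * b'); rewrite !mulf_neq0 //; split=> //.
  - exact: GM.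
  - exact: GM.
  - by rewrite ei ej addrACA.
have degN i : quotient_degree G i -> quotient_degree G (- i).
  by move=> [p [q [a [b [ha hb a0 b0 ei]]]]]; exists q, p, b, a; split=> //; rewrite ei addKr.
have deg_of i a : G i a -> a != 0 -> quotient_degree G i.
  by move=> ha a0; exists (i + omega), omega, (a * F), F; rewrite mulf_neq0 //; split=> //; apply: GM.
have degMz i k : quotient_degree G i -> quotient_degree G (k * i).
  move=> hi; have hn n : quotient_degree G (n%:Z * i).
    elim: n => [|n IH]; first by exists omega, omega, F, F; rewrite mul0r add0r.
    by rewrite intS mulrDl mul1r; apply: degD.
  by case: k => n //; rewrite NegzE mulNr; apply: degN.
have [d [d0 hd dmin]] : exists d : nat, [/\ (0 < d)%N, quotient_degree G d%:Z &
    forall d', (0 < d')%N -> quotient_degree G d'%:Z -> (d <= d')%N].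
  have : exists d : nat, (0 < d)%N /\ quotient_degree G d%:Z.
    exists `|omega|%N; rewrite absz_gt0 w0; split=> //.
    have hw := deg_of _ _ GF F0; rewrite abszE.
    by case: (ger0P omega) => _ //; apply: degN.
  case=> d; have [k] := ubnP d; elim: k d => // k IH d hk [d0 hd].
  case: (classic (exists d', [/\ (0 < d')%N, quotient_degree G d'%:Z & (d' < d)%N])).
    by case=> d' [d0' hd' ltd]; apply: (IH d') => //; lia.
  move=> no; exists d; split=> // d' d0' hd'; rewrite leqNgt; apply/negP => ltd.
  by apply: no; exists d'.
exists d%:Z; split=> // [|i a ha a0]; first by rewrite eqz_nat -lt0n.
have hi := deg_of _ _ ha a0.
have hr : quotient_degree G (i %% d%:Z)%Z.
  have -> : (i %% d%:Z)%Z = i + (- (i %/ d%:Z)%Z) * d%:Z.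
    by rewrite {2}(divz_eq i d%:Z) mulNr; ring.
  by apply: degD => //; apply: degMz.
apply/dvdz_mod0P; have r0 : (0 <= (i %% d%:Z)%Z)%R by apply: modz_ge0; lia.
have rd : ((i %% d%:Z)%Z < d%:Z)%R by apply: ltz_pmod.
move: hr r0 rd; case: (i %% d%:Z)%Z => // r hr _ rd; congr Posz.
by case: r hr rd => // r hr rd; have := dmin r.+1 isT hr; lia.
Qed.

Definition trivial_grading (A : idomainType) (i : int) (x : A) := i = 0 \/ x = 0.

Lemma trivial_gradingP (A : idomainType) : Zgrading (@trivial_grading A).
Proof.
split.
- move=> i; split; first by right.
  by move=> x y [->|->] [hi|->]; rewrite ?subr0; [left|left|left|right].
- by move=> i j x y [->|->] [->|->]; rewrite ?mulr0 ?mul0r; [left|right|right|right].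
- move=> a; exists [:: 0], (fun i => if i == 0 then a else 0); rewrite big_seq1 eqxx; split=> //.
  by move=> i; case: eqP => [->|_]; [left|right].
move=> s f us hf e0.
have f0 i : i != 0 -> f i = 0 by case: (hf i) => [->|//]; rewrite eqxx.
move=> i si; have [i0|/f0 //] := eqVneq i 0; rewrite i0 in si *.
move: e0; rewrite (perm_big _ (perm_to_rem si)) big_cons /= big_seq big1 => [|j].
  by rewrite addr0.
by rewrite mem_rem_uniq // inE => /andP [/f0].
Qed.

Lemma degree0_completion n (e : 'I_n.+1 -> nat) :
  gcdn (\big[gcdn/0%N]_(i < n.+1) e i) 0 = 1%N ->
  exists M : 'M[int]_n.+2, [/\ M \in unitmx, relrow e 0 *m M = delta_mx 0 0 &
    row ord0 M = delta_mx 0 (lift ord0 ord0)].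
Proof.
move=> h; pose v : 'rV[int]_n.+1 := \row_j (e j)%:Z.
have [|N uN vN] := @unimodular_completion n v.
  move=> d hd; apply/eqP; rewrite -dvdn1 -h gcdn0.
  by apply/dvdn_biggcdP => j _; have := hd j; rewrite mxE.
pose D : 'M[int]_(1 + n.+1) := block_mx 1%:M 0 0 N.
pose P : 'M[int]_(1 + n.+1) := tperm_mx ord0 (lift ord0 ord0).
have uD : D \in unitmx by rewrite unitmxE det_ublock det1 mul1r -unitmxE.
have deltaP (i : 'I_(1 + n.+1)) : (delta_mx 0 i : 'rV[int]_(1 + n.+1)) *m P =
    delta_mx 0 (tperm ord0 (lift ord0 ord0) i).
  by rewrite -rowE; apply/rowP => k; rewrite !mxE eqxx /= eq_sym.
exists (D *m P); split.
- by rewrite [_ \in _](unitmx_mul D P) uD [_ \in _]unitmx_perm.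
- have -> : relrow e 0 = row_mx 0 v :> 'rV[int]_(1 + n.+1).
    apply/rowP => i; rewrite !mxE; case: splitP => j ej; rewrite !mxE.
      by rewrite (_ : i = ord0) ?ocons0 ?oppr0 //; apply: val_inj; rewrite /= ej ord1.
    by rewrite (_ : i = lift ord0 j) ?oconsS //; apply: val_inj; rewrite /= ej.
  have e1 : row_mx 0 v *m D = delta_mx 0 (lift ord0 ord0).
    rewrite mul_row_block !mul0mx mulmx0 !add0r vN.
    apply/rowP => i; rewrite !mxE; case: splitP => j ej; rewrite !mxE /=.
      by rewrite -val_eqE /= ej ord1.
    by rewrite -!val_eqE /= ej.
  by rewrite [LHS](mulmxA _ D P) e1 deltaP tpermR.
have d0 : delta_mx 0 ord0 = row_mx 1%:M 0 :> 'rV[int]_(1 + n.+1).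
  apply/rowP => i; rewrite !mxE; case: splitP => j ej; rewrite !mxE /=.
    by rewrite -val_eqE /= ej ord1.
  by rewrite -!val_eqE /= ej.
have e0 : row_mx 1%:M 0 *m D = row_mx 1%:M 0.
  by rewrite mul_row_block !mul1mx !mul0mx !addr0.
rewrite rowE [LHS](mulmxA _ D P).
rewrite (etrans (congr1 (mulmx^~ D) d0) (etrans e0 (esym d0))).
by rewrite deltaP tpermL.
Qed.

Theorem theorem3p17 (A : idomainType) (G : int -> A -> Prop) (omega : int)
    (F : A) (n : nat) (e : 'I_n -> nat) :
  Zgrading G -> G omega F -> F != 0 -> (1 <= n)%N ->
  (forall i, (1 <= e i)%N) ->
  gcdn (\big[gcdn/0%N]_(i < n) e i) `|omega|%N = 1%N ->
  let g : {mpoly A[n]} := \prod_(i < n) 'X_i ^+ e i - F%:MP in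
  prime_principal_ideal g /\
  (noetherian A -> UFD A -> prime_elt F ->
   forall (B : idomainType) (phi : {rmorphism {mpoly A[n]} -> B}),
     (forall b : B, exists p, phi p = b) ->
     (forall p, phi p = 0 <-> pdvd g p) ->
     UFD B /\
     exists f : {rmorphism {fraction B} -> {fraction {mpoly {fraction A}[n.-1]}}},
       bijective f).
Proof.
case: n e => [//|n] e gr GF F0 _ e_gt0 gcd1 g.
pose K := {fraction A}; pose L := {fraction {mpoly K[n.+1]}}.
pose frac : {rmorphism A -> K} := tofrac.
pose kap : {rmorphism {mpoly K[n.+1]} -> L} := tofrac.
have frac_inj : injective frac by exact: tofrac_inj.
have kap_inj : injective kap by exact: tofrac_inj.
have [M M_unit M_rel] := unimodular_completion (primitive_relrow gcd1).
have c0 : rowmon F frac kap M ord0 != 0 by exact: rowmon_neq0.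
have has_one := grade_one gr GF F0.
have [|||psi [psiC psiX]] := @twist_mpoly A G gr L (embed frac kap)
    (fun i => rowmon F frac kap M ord0 ^ i) _ _ _ n.+1
    (fun j => rowmon F frac kap M (lift ord0 j)).
- exact: expr0z.
- by move=> i j _ _ _ _ _ _; apply: expfzDr.
- exact: has_one.
have ker := psi_kernel gr GF F0 e_gt0 frac_inj kap_inj M_unit M_rel psiC psiX.
split.
  split=> [/ker|a b /ker]; first by rewrite rmorph1; apply/eqP/oner_neq0.
  by rewrite rmorphM => /eqP; rewrite mulf_eq0 => /orP [] /eqP /ker; [left|right].
move=> _ ufdA pF B phi surj phi_ker; have [_ F_nonunit _] := pF.
have [|psiB psiB_phi] := @rmorphism_factor _ _ _ phi psi surj.
  by move=> p /phi_ker /ker.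
split.
  apply: factorial_UFD.
  exact: (@quotient_factorial A G omega F n e gr GF F0 e_gt0 (UFD_factorial ufdA)
    (prime_elt_wprime pF) F_nonunit B phi surj phi_ker K L {fraction {poly B}}
    frac kap tofrac frac_inj kap_inj (@tofrac_inj _) M M_unit M_rel psi psiC psiX
    psiB psiB_phi).
pose kap' : {rmorphism {mpoly K[n]} -> {fraction {mpoly K[n]}}} := tofrac.
have [w0|w0] := eqVneq omega 0.
  have [|N [N_unit N_rel N_row]] := @degree0_completion n e; first by rewrite w0 in gcd1.
  apply: (@fraction_field_iso A (@trivial_grading A) 0 F n e (@trivial_gradingP A)
    (or_introl erefl) F0 B phi surj phi_ker K _ {fraction B} frac kap' tofrac
    frac_inj (@tofrac_inj _) (@tofrac_inj _) (@fraction_rep _) (@fraction_rep _)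
    (@fraction_rep _) 0 0 0 0 1 1 (or_introl erefl) (or_introl erefl)
    (oner_neq0 _) (oner_neq0 _) _ _ _ N N_unit N_rel (fun=> N_row)).
  - by [].
  - by [].
  - by move=> i a [->|->]; rewrite ?dvdzz ?eqxx.
have [delta [d0 [p1 [p2 [t1 [t2 [ht1 ht2 t10 t20 ep]]]]]] ddvd] := degree_generator gr GF F0 w0.
have /dvdzP [m em] := ddvd _ _ GF F0.
have gcdm : gcdn (\big[gcdn/0%N]_(i < n.+1) e i) `|m|%N = 1%N.
  apply/eqP; rewrite -dvdn1 -gcd1 dvdn_gcd dvdn_gcdl /=.
  by apply: dvdn_trans (dvdn_gcdr _ _) _; rewrite em abszM dvdn_mulr.
have [N N_unit N_rel] := unimodular_completion (primitive_relrow gcdm).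
apply: (@fraction_field_iso A G omega F n e gr GF F0 B phi surj phi_ker K _ {fraction B}
  frac kap' tofrac frac_inj (@tofrac_inj _) (@tofrac_inj _) (@fraction_rep _)
  (@fraction_rep _) (@fraction_rep _) delta m p1 p2 t1 t2 ht1 ht2 t10 t20 ep em ddvd
  N N_unit N_rel).
by move=> d0'; rewrite d0' eqxx in d0.
Qed.
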